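(* Let $\mathcal{O}\subset K$ be an order in a sextic CM field $K$. (1) If $K$ contains no imaginary quadratic subfield, then there exists $\mu\in\mathcal{O}$ such that $\mu^2$ is totally real, $K=\mathbb{Q}(\mu)$ and $$0<-\tfrac12\mathrm{Tr}_{K/\mathbb{Q}}(\mu^2)\le\left(\tfrac{6}{\pi}\right)^{2/3}|\Delta(\mathcal{O})|^{1/3}.$$ (2) If $K$ contains an imaginary quadratic subfield $K_1$, let $K_+$ be the totally real cubic subfield of $K$ and let $\mathcal{O}_i=K_i\cap\mathcal{O}$ for $i\in\{1,+\}$. Then there exists $\mu\in\mathcal{O}$ such that $\mu^2$ is totally real, $K=\mathbb{Q}(\mu)$ and $$0<-\tfrac12\mathrm{Tr}_{K/\mathbb{Q}}(\mu^2)\le|\Delta(\mathcal{O}_1)|\left(1+2\sqrt{|\Delta(\mathcal{O}_+)|}\right).$$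
   Context: A CM field is an imaginary quadratic extension of a totally real number field; sextic means of degree $6$ over $\mathbb{Q}$. $\Delta(\cdot)$ denotes the discriminant of an order in a number field. *)

(* Defs.v *)
From HB Require Import structures.
From mathcomp Require Import all_boot all_order all_algebra all_field.
From mathcomp Require Import boolp classical_sets reals exp trigo.

Set Implicit Arguments.
Unset Strict Implicit.
Unset Printing Implicit Defensive.

Import Order.TTheory GRing.Theory Num.Theory passmx.
Local Open Scope ring_scope.

(* Number fields are finite extensions [L : fieldExtType rat].  A subfield
   [F : {subfield L}] is itself the number field [subvs_of F].  Embeddings into
   the complex numbers have algebraic values, hence the codomain [algC]. *)

Definition totally_real (L : fieldExtType rat) : Prop :=
  forall (f : {rmorphism L -> algC}) (x : L), f x \is Num.real.

Definition totally_imaginary (L : fieldExtType rat) : Prop :=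
  forall f : {rmorphism L -> algC}, exists x : L, f x \isn't Num.real.

Definition totally_real_elt (L : fieldExtType rat) (x : L) : Prop :=
  forall f : {rmorphism L -> algC}, f x \is Num.real.

Definition CM_field (L : fieldExtType rat) : Prop :=
  totally_imaginary L /\
  exists F : {subfield L}, totally_real (subvs_of F) /\ \dim_F {:L} = 2%N.

Definition imaginary_quadratic (L : fieldExtType rat) : Prop :=
  \dim {:L} = 2%N /\ totally_imaginary L.

Definition field_trace (L : fieldExtType rat) (x : L) : rat :=
  \tr (mxof (vbasis {:L}) (vbasis {:L}) (amull x)).

Lemma field_trace_is_linear (L : fieldExtType rat) :
  linear (@field_trace L : L -> rat^o).
Proof. by move=> a x y; rewrite /field_trace !linearP. Qed.

HB.instance Definition _ (L : fieldExtType rat) :=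
  GRing.isLinear.Build rat L rat^o _ (@field_trace L) (@field_trace_is_linear L).

Section Orders.
Variable L : fieldExtType rat.
Implicit Types (O : {pred L}) (b : (\dim {:L}).-tuple L).

(* A Z-basis is required to be a Q-basis of L, so O has full rank [L : Q]. *)
Definition is_zbasis O b : Prop :=
  basis_of {:L} b /\ forall x, x \in O <-> inIntSpan b x.

Definition is_order O : Prop :=
  subring_closed O /\ exists b, is_zbasis O b.

Definition zdisc b : rat :=
  \det (\matrix_(i, j) field_trace (tnth b i * tnth b j)).

(* The default value [vbasis {:L}] is only reached when O has no Z-basis;
   [order_discE] shows that the choice of the Z-basis is immaterial. *)
Definition order_disc O : rat :=
  zdisc (xget (vbasis {:L}) [set b | is_zbasis O b]).

Lemma zdisc_zbasis O b c : is_zbasis O b -> is_zbasis O c -> zdisc b = zdisc c.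
Proof.
have aux (x : rat) (m n : int) : x *~ m *~ n = n%:~R * x * m%:~R.
  by rewrite -[LHS]mulrzl -(mulrzr x) mulrA.
have step b1 b2 : is_zbasis O b1 -> is_zbasis O b2 ->
    exists z : int, zdisc b2 = z%:~R ^+ 2 * zdisc b1.
  move=> [_ O1] [_ O2].
  have /choice[a aE] i : exists a : int ^ (\dim {:L}),
      tnth b2 i = \sum_(k < \dim {:L}) b1`_k *~ a k.
    apply/O1/O2; exists [ffun k => (k == i)%:Z].
    rewrite (bigD1 i) //= ffunE eqxx (tnth_nth 0) big1 ?addr0 // => k /negPf ki.
    by rewrite ffunE ki.
  pose A : 'M[int]_(\dim {:L}) := \matrix_(i, k) a i k.
  exists (\det A); rewrite -det_map_mx expr2 -mulrA [\det _ * zdisc _]mulrC.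
  rewrite -{2}det_tr mulrA -!det_mulmx; congr (\det _).
  apply/matrixP => i j; rewrite mxE !aE mulr_suml.
  rewrite (linear_sum (@field_trace L)) mxE.
  under [RHS]eq_bigr do rewrite !mxE mulr_suml.
  rewrite [RHS]exchange_big; apply: eq_bigr => k _.
  rewrite mulr_sumr (linear_sum (@field_trace L)); apply: eq_bigr => l _.
  rewrite !mxE !(tnth_nth 0) mulrzAl mulrzAr 2!(raddfMz (@field_trace L)).
  exact: aux.
move=> bO cO; have [z cE] := step _ _ bO cO; have [t bE] := step _ _ cO bO.
have [c0|c_neq0] := eqVneq (zdisc c) 0; first by rewrite bE c0 mulr0.
have /eqP : (t * z)%:~R ^+ 2 * zdisc c = zdisc c.
  by rewrite intrM exprMn [_ ^+ 2 * _]mulrC -mulrA -bE -cE.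
rewrite -subr_eq0 -{2}[zdisc c]mul1r -mulrBl mulf_eq0 (negPf c_neq0) orbF.
rewrite subr_eq0 -rmorphXn /= -[1]/(1%:~R) eqr_int => /eqP/(congr1 absz).
rewrite abszX abszM => /eqP; rewrite (eqn_exp2r _ 1) ?muln_eq1 => [/andP[_]|//].
move=> /eqP z1; rewrite cE -rmorphXn /= -[z ^+ 2]real_normK ?num_real //.
by rewrite -abszE z1 mul1r.
Qed.

Lemma order_discE O b : is_zbasis O b -> order_disc O = zdisc b.
Proof.
by move=> bO; rewrite /order_disc; case: xgetP => [c _ cO|/(_ b)//];
  apply: zdisc_zbasis bO.
Qed.

End Orders.

Definition subfield_order (L : fieldExtType rat) (F : {subfield L})
  (O : {pred L}) : {pred subvs_of F} := [pred x | vsval x \in O].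
Arguments subfield_order {L} F O.

(* Main.v *)
Require Import Defs.
From HB Require Import structures.
From mathcomp Require Import all_boot all_order all_algebra all_field.
From mathcomp Require Import boolp classical_sets reals exp trigo.
From mathcomp Require Import perm topology normedtype derive ring lra.

Set Implicit Arguments.
Unset Strict Implicit.
Unset Printing Implicit Defensive.

Import Order.TTheory GRing.Theory Num.Theory passmx numFieldNormedType.Exports.
Local Open Scope ring_scope.

(** Write K = F + s F with F totally real cubic and s^2 in F totally negative.
An element mu outside F with mu^2 in F is one of V = s F, and on V the form
q(x) = - Tr(x^2) / 2 is positive definite: it is the sum of |f(x)|^2 over the
three pairs of conjugate embeddings f.  So the task is to find short vectors of
a lattice of rank at most 3, for which Hermite's inequality
  q(u)^n <= (4/3)^(n(n-1)/2) det q
([hermite]) suffices: no volumes are computed.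

Part (1).  An order need not be stable under complex conjugation, so the
difference of an element and its conjugate may leave it; mu is therefore sought
directly in O meet V, a lattice of rank 3.  A Z-basis of O meet V extends to a
Z-basis of O ([adapted_zbasis]); replacing the three other basis vectors c_j by
their components p_j in F makes the trace form block diagonal without changing
its determinant.  The block of V is -2 q.  The block of F is half of the matrix
2 Tr(p_i p_j) = Tr(c_i (c_j + conj c_j)), which is made of traces of algebraic
integers, so it has a nonzero integer determinant.  Hence det q <= |disc O|
([discriminant_split]) and Hermite gives q(mu)^3 <= (4/3)^3 |disc O|; finally
(4/3)^3 <= (6/pi)^2 since pi <= 18/5.  If mu^2 were rational, Q(mu) would be an
imaginary quadratic subfield; otherwise Q(mu^2) = F, whence Q(mu) = K
([adjoin_root_full]).

Part (2).  Take mu = delta alpha with delta a square root of the discriminant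
of O_1 in O_1 ([quadratic_order_sqrt_disc]) and alpha a short irrational element
of the order O_+ of the cubic field.  Projecting O_+ orthogonally to 1, a vector
of squared length 3, leaves a plane lattice of determinant disc(O_+)/3; by
Hermite it has a vector of squared length at most (2/3) sqrt(disc O_+), and
lifting it back to O_+ costs at most 3/4 ([cubic_order_short]).  Then
- Tr(mu^2) / 2 = |disc O_1| Tr(alpha^2), because the trace of K is twice that
of the cubic field ([trace_quadratic]).

Everything said about traces comes from one formula: the trace of an element is
the sum of its images under [K : Q] embeddings in the algebraic numbers
([trace_embeddings]). *)

(** * Hermite's inequality for rational quadratic forms *)

Definition qform (R : pzRingType) n (G : 'M[R]_n) (u : 'rV[R]_n) : R :=
  (u *m G *m u^T) 0 0.

Definition posdef (R : numDomainType) n (G : 'M[R]_n) : Prop :=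
  G^T = G /\ forall u, u != 0 -> 0 < qform G u.

Lemma common_denominator m n (A : 'M[rat]_(m, n)) :
  exists2 N : int, 0 < N &
    exists B : 'M[int]_(m, n), N%:~R *: A = map_mx intr B.
Proof.
pose N := \prod_i \prod_j denq (A i j).
have N0 : 0 < N by apply: prodr_gt0 => i _; apply: prodr_gt0.
exists N => //.
exists (\matrix_(i, j) numq (N%:~R * A i j)); apply/matrixP => i j.
rewrite !mxE -[in RHS]/(_%:~R) numqE.
suff -> : denq (N%:~R * A i j) = 1 by rewrite mulr1.
apply/eqP; rewrite -Qint_def.
rewrite /N (bigD1 i) //= (bigD1 j) //= !intrM -!mulrA mulrC -!mulrA.
by rewrite -numqE -!intrM rpred_int.
Qed.

Lemma round_half (x : rat) : exists k : int, (k%:~R + x) ^+ 2 <= 1 / 4.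
Proof.
exists (- Num.floor (x + 1 / 2)); set f := Num.floor _.
have /andP[h1 h2] : (f%:~R <= x + 1 / 2) && (x + 1 / 2 < (f + 1)%:~R).
  exact: floor_itv.
rewrite intrD in h2.
by rewrite rmorphN /=; nra.
Qed.

(** Completing the square: the Schur complement of the first coordinate is the
form induced on the orthogonal complement of the first basis vector. *)
Section Schur.
Variables (n : nat) (a : rat) (b : 'rV[rat]_n) (C : 'M[rat]_n).
Hypothesis a_gt0 : 0 < a.

Definition schur : 'M[rat]_n := C - a^-1 *: (b^T *m b).

Let G : 'M[rat]_(1 + n) := block_mx a%:M b b^T C.

Lemma det_schur : \det G = a * \det schur.
Proof.
have an0 : a != 0 by rewrite gt_eqF.
have -> : G = block_mx a%:M 0 b^T schur *m block_mx 1%:M (a^-1 *: b) 0 1%:M.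
  rewrite mulmx_block !(mulmx1, mulmx0, mul0mx, addr0, add0r) mul_scalar_mx.
  by rewrite scalerA divff // scale1r -scalemxAr /schur addrC subrK.
by rewrite det_mulmx det_lblock det_ublock !det1 det_scalar1 !mulr1.
Qed.

Lemma qform_schur (k : rat) (w : 'rV[rat]_n) :
  qform G (row_mx k%:M w) =
  a * (k + (b *m w^T) 0 0 / a) ^+ 2 + qform schur w.
Proof.
have an0 : a != 0 by rewrite gt_eqF.
rewrite /qform /G mul_row_block tr_row_mx mul_row_col !mulmxDl tr_scalar_mx.
rewrite !mul_mx_scalar !mul_scalar_mx.
have -> : w *m b^T = (b *m w^T)^T by rewrite trmx_mul trmxK.
set s := b *m w^T; set q := w *m C *m w^T.
have -> : w *m schur *m w^T = q - a^-1 *: (s^T *m s).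
  rewrite /schur mulmxBr mulmxBl -scalemxAr -scalemxAl !mulmxA.
  by rewrite /q /s trmx_mul trmxK ?mulmxA.
have sE : (s^T *m s) 0 0 = s 0 0 ^+ 2 :> rat by rewrite mxE big_ord1 mxE expr2.
move: (s^T *m s) sE => t sE.
rewrite -scalemxAl -/s; clearbody s q; rewrite !mxE sE eqxx mulr1n.
by field.
Qed.

End Schur.

Lemma qform_intr n (G : 'M[int]_n) (u : 'rV[int]_n) :
  qform (map_mx intr G) (map_mx intr u) = (qform G u)%:~R :> rat.
Proof. by rewrite /qform map_trmx -!map_mxM mxE. Qed.

Lemma qformZ (R : comPzRingType) n (G : 'M[R]_n) c u :
  qform G (c *: u) = c ^+ 2 * qform G u.
Proof. by rewrite /qform linearZ -!scalemxAl -scalemxAr scalerA mxE expr2. Qed.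

Lemma qform_congr (R : comPzRingType) n (G U : 'M[R]_n) u :
  qform (U *m G *m U^T) u = qform G (u *m U).
Proof. by rewrite /qform trmx_mul !mulmxA. Qed.

Lemma map_intr_eq0 m n (u : 'M[int]_(m, n)) :
  (map_mx intr u == 0 :> 'M[rat]_(m, n)) = (u == 0).
Proof.
apply/eqP/eqP => [/matrixP u0|->]; last by rewrite map_mx0.
apply/matrixP => i j; have := u0 i j.
by rewrite !mxE => /eqP; rewrite intr_eq0 => /eqP.
Qed.

(** The values on integer vectors have a bounded denominator, so the minimum is
taken over a set of natural numbers. *)
Lemma shortest_vector n (G : 'M[rat]_n.+1) : posdef G ->
  exists2 u : 'rV[int]_n.+1, u != 0 &
    forall v : 'rV[int]_n.+1, v != 0 ->
      qform G (map_mx intr u) <= qform G (map_mx intr v).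
Proof.
move=> [_ Gpos]; have [N N0 [B GB]] := common_denominator G.
have N0' : 0 < N%:~R :> rat by rewrite ltr0z.
have qE v : N%:~R * qform G (map_mx intr v) = (qform B v)%:~R.
  by rewrite -qform_intr -GB /qform -scalemxAr -scalemxAl [RHS]mxE.
have Bpos v : v != 0 -> 0 < qform B v.
  move=> v0; rewrite -(ltr0z rat) -qE mulr_gt0 //.
  by apply: Gpos; rewrite map_intr_eq0.
pose e : 'rV[int]_n.+1 := delta_mx 0 0.
have e0 : e != 0.
  by apply/eqP => /rowP/(_ 0); rewrite !mxE !eqxx.
have exk : exists k : nat, `[< exists2 u, u != 0 & qform B u = k :> int >].
  exists `|qform B e|%N; apply/asboolP; exists e => //.
  by rewrite gtz0_abs // Bpos.
case: (ex_minnP exk) => k /asboolP[u u0 uk] kmin; exists u => // v v0.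
rewrite -(ler_pM2l N0') !qE ler_int uk -(gtz0_abs (Bpos v v0)) lez_nat.
by apply: kmin; apply/asboolP; exists v; rewrite // gtz0_abs ?Bpos.
Qed.

(** This is the Smith normal form of a one-row matrix; the rows of a unimodular
matrix are the vectors that extend to a basis of the integer lattice. *)
Lemma unimodular_first_row n (u : 'rV[int]_n.+1) :
  exists2 U, U \in unitmx & exists d : int, u = d *: row 0 U.
Proof.
have [L _ [U Uu [d _ ->]]] := int_Smith_normal_form u.
exists U => //; exists (L 0 0 * d`_0).
rewrite [L]mx11_scalar mul_scalar_mx -scalemxAl; apply/rowP => j.
rewrite !mxE (bigD1 0) //= big1 => [|i i0]; last first.
  by rewrite !mxE eq_sym (negPf (i0 : (i : nat) != 0%N)) mulr0n mul0r.
by rewrite !mxE eqxx mulr1n addr0 mulrA.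
Qed.

Lemma det_unimodular_sqr n (U : 'M[int]_n) : U \in unitmx -> (\det U) ^+ 2 = 1.
Proof. by rewrite unitmxE => /orP[] /eqP ->. Qed.

Lemma map_intr_unitmx n (U : 'M[int]_n) :
  U \in unitmx -> (map_mx intr U : 'M[rat]_n) \in unitmx.
Proof. by rewrite !unitmxE det_map_mx; apply: rmorph_unit. Qed.

Lemma posdef_congr n (G U : 'M[rat]_n) :
  posdef G -> U \in unitmx -> posdef (U *m G *m U^T).
Proof.
move=> [Gsym Gpos] Uu; split; first by rewrite !trmx_mul trmxK Gsym mulmxA.
move=> u u0; rewrite qform_congr; apply: Gpos; apply: contraNneq u0 => uU.
by rewrite -(mulmxK Uu u) uU mul0mx.
Qed.

(** The first coordinate of a lift is free up to integers, so it can be rounded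
until the component along the first basis vector is at most half of it. *)
Lemma schur_lift n (a : rat) (b : 'rV[rat]_n) C (w : 'rV[int]_n) : 0 < a ->
  exists k : int,
    qform (block_mx a%:M b b^T C : 'M_(1 + n)) (map_mx intr (row_mx k%:M w))
    <= a / 4 + qform (schur a b C) (map_mx intr w).
Proof.
move=> a0; pose x := (b *m (map_mx intr w)^T) 0 0 / a.
have [k kx] := round_half x; exists k.
rewrite map_row_mx map_scalar_mx qform_schur // lerD2r -/x.
by rewrite ler_wpM2l // ltW.
Qed.

Lemma schur_posdef n (a : rat) (b : 'rV[rat]_n) C : 0 < a ->
  posdef (block_mx a%:M b b^T C : 'M_(1 + n)) -> posdef (schur a b C).
Proof.
move=> a0 [Gsym Gpos]; split.
  have := Gsym; rewrite tr_block_mx => /eq_block_mx[_ _ _ CT].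
  by rewrite /schur linearB linearZ /= trmx_mul trmxK CT.
move=> w w0; set k := - ((b *m w^T) 0 0 / a).
suff : 0 < qform (block_mx a%:M b b^T C : 'M_(1 + n)) (row_mx k%:M w).
  by rewrite qform_schur // addNr expr0n mulr0 add0r.
apply: Gpos; apply: contraNneq w0 => kw.
by rewrite -(row_mxKr k%:M w) kw linear0.
Qed.

(** Induction on the rank.  Make a shortest vector r, of squared length a, the
first basis vector and let w be short in the lattice projected orthogonally to
r.  Some lift of w has length at most a/4 + q'(w), and is no shorter than r, so
a <= 4/3 q'(w); combine with the bound on q'(w) and det q = a det q'. *)
Theorem hermite n (G : 'M[rat]_n.+1) : posdef G ->
  exists2 u : 'rV[int]_n.+1, u != 0 &
    qform G (map_mx intr u) ^+ n.+1 <= (4 / 3) ^+ 'C(n.+1, 2) * \det G.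
Proof.
elim: n G => [|n IHn] G Gpos.
  exists (const_mx 1); first by apply/eqP => /matrixP/(_ 0 0); rewrite !mxE.
  rewrite expr1 expr0 mul1r [G]mx11_scalar det_scalar1 map_const_mx.
  by rewrite /qform mul_mx_scalar !mxE big_ord1 !mxE !mulr1.
have [u u0 umin] := shortest_vector Gpos.
have [U Uu [d uE]] := unimodular_first_row u.
pose U' : 'M[rat]_n.+2 := map_mx intr U.
(* As u = d *: r, the vector r is a shortest one too. *)
set r := row 0 U in uE.
have r0 : r != 0 by apply: contraNneq u0 => r0; rewrite uE r0 scaler0.
have qr0 : 0 < qform G (map_mx intr r) by rewrite Gpos.2 // map_intr_eq0.
have rmin v : v != 0 -> qform G (map_mx intr r) <= qform G (map_mx intr v).
  move=> /umin; apply: le_trans; rewrite uE map_mxZ /= qformZ.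
  have d0 : d != 0 by apply: contraNneq u0 => d0; rewrite uE d0 scale0r.
  rewrite ler_peMl ?(ltW qr0) // -rmorphXn /= ler1z.
  by rewrite -gtz0_ge1 exprn_even_gt0.
pose H : 'M_(1 + n.+1) := U' *m G *m U'^T.
have Hpos : posdef H by apply: posdef_congr => //; apply: map_intr_unitmx.
have qH v : qform H (map_mx intr v) = qform G (map_mx intr (v *m U)).
  by rewrite qform_congr map_mxM.
have vU (v : 'rV_n.+2) : v != 0 -> v *m U != 0.
  by apply: contraNneq => vU0; rewrite -(mulmxK Uu v) vU0 mul0mx.
pose a := qform G (map_mx intr r).
have HE : H = block_mx a%:M (ursubmx H) (ursubmx H)^T (drsubmx H).
  rewrite -[LHS]submxK; congr block_mx; last first.
    by rewrite trmx_ursub Hpos.1.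
  rewrite [LHS]mx11_scalar; congr _%:M.
  rewrite /a /r rowE -qH /qform map_delta_mx -rowE trmx_delta -colE.
  rewrite !mxE; apply: eq_bigr => j _.
  by congr ((U' *m G) _ _ * U'^T _ _); apply: val_inj.
rewrite HE in Hpos; have Spos := schur_posdef qr0 Hpos.
have [w w0 wS] := IHn _ Spos.
have [k kw] := schur_lift (ursubmx H) (drsubmx H) w qr0.
exists r => //; rewrite -HE qH -/a in kw *.
have detG : \det G = \det H.
  rewrite !det_mulmx det_tr mulrAC -expr2 det_map_mx -rmorphXn /=.
  by rewrite det_unimodular_sqr // mul1r.
rewrite detG HE det_schur //.
set S := schur _ _ _ in Spos wS kw *.
have aS : a <= 4 / 3 * qform S (map_mx intr w).
  have : a <= qform G (map_mx intr (row_mx k%:M w *m U)).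
    apply/rmin/vU; apply: contraNneq w0 => kw0.
    by rewrite -(row_mxKr k%:M w) kw0 linear0.
  by move=> /le_trans /(_ kw); lra.
rewrite [leLHS]exprS binS bin1 exprD [leRHS]mulrCA ler_pM2l //.
apply: le_trans (_ : (4 / 3 * qform S (map_mx intr w)) ^+ n.+1 <= _).
  by rewrite lerXn2r // nnegrE ?(ltW qr0) // (le_trans (ltW qr0)).
by rewrite exprMn -mulrA [leRHS]mulrCA ler_pM2l // exprn_gt0.
Qed.

Lemma posdef_det n (G : 'M[rat]_n.+1) : posdef G -> 0 < \det G.
Proof.
move=> Gpos; have [u u0 uG] := hermite Gpos.
have : 0 < (4 / 3) ^+ 'C(n.+1, 2) * \det G.
  by apply: lt_le_trans uG; rewrite exprn_gt0 // Gpos.2 // map_intr_eq0.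
by rewrite pmulr_rgt0 // exprn_gt0.
Qed.

(** * The trace as a sum over embeddings *)
Section Embeddings.
Variable L : fieldExtType rat.

Lemma separable_element_rat (x : L) : separable_element 1 x.
Proof. by apply: pcharf0_separable => p; rewrite pchar_lalg pchar_num. Qed.

Lemma primitive_element : exists t : L, <<1; t>>%VS = {:L}%VS.
Proof.
exists (separable_generator 1 {:L}).
rewrite -eq_adjoin_separable_generator ?sub1v //.
by apply/allP => x _; apply: separable_element_rat.
Qed.

(** Evaluation at z of any polynomial expression in the primitive element t is
well defined, since z is a root of the minimal polynomial of t. *)
Lemma embedding_of_root (t : L) (z : algC) (p : {poly rat}) :
  <<1; t>>%VS = {:L}%VS -> map_poly (in_alg L) p = minPoly 1 t ->
  root (map_poly ratr p) z -> exists f : {rmorphism L -> algC}, f t = z.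
Proof.
move=> tL pE pz.
have /choice[Q QE] (x : L) :
    exists q : {poly rat}, (map_poly (in_alg L) q).[t] = x.
  have /polyOver1P[q qE] := Fadjoin_polyOver 1%AS t x.
  by exists q; rewrite -qE Fadjoin_poly_eq // tL memvf.
have kerP (q : {poly rat}) :
    (map_poly (in_alg L) q).[t] = 0 -> (map_poly ratr q).[z] = 0 :> algC.
  move=> /rootP qt; apply/rootP.
  have : minPoly 1 t %| map_poly (in_alg L) q.
    by apply: minPoly_dvdp => //; apply/polyOver1P; exists q.
  rewrite -pE dvdp_map => /dvdpP[r ->].
  by rewrite rmorphM /= rootM pz orbT.
have eqP' (q r : {poly rat}) :
    (map_poly (in_alg L) q).[t] = (map_poly (in_alg L) r).[t] ->
    (map_poly ratr q).[z] = (map_poly ratr r).[z] :> algC.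
  move=> qr; apply/eqP; rewrite -subr_eq0 -hornerN -hornerD -!rmorphB /=.
  by apply/eqP/kerP; rewrite rmorphB /= hornerD hornerN qr subrr.
pose g x := (map_poly ratr (Q x)).[z] : algC.
have gB : zmod_morphism g.
  move=> x y; rewrite /g -hornerN -hornerD -rmorphB /=.
  by apply: eqP'; rewrite rmorphB /= hornerD hornerN !QE.
have gM : monoid_morphism g.
  split=> [|x y]; rewrite /g.
    transitivity ((map_poly ratr (1%:P : {poly rat})).[z] : algC).
      by apply: eqP'; rewrite QE rmorph1 hornerC.
    by rewrite rmorph1 hornerC.
  by rewrite -hornerM -rmorphM /=; apply: eqP'; rewrite rmorphM /= hornerM !QE.
pose ga := GRing.isZmodMorphism.Build _ _ g gB.
pose gm := GRing.isMonoidMorphism.Build _ _ g gM.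
pose gf : {rmorphism L -> algC} := HB.pack g ga gm.
exists gf; transitivity ((map_poly ratr ('X : {poly rat})).[z] : algC).
  by apply: eqP'; rewrite QE map_polyX hornerX.
by rewrite map_polyX hornerX.
Qed.

Lemma embedding_alg (f : {rmorphism L -> algC}) (a : rat) (x : L) :
  f (a *: x) = ratr a * f x.
Proof.
by rewrite -mulr_algl rmorphM -[in RHS](fmorph_eq_rat (f \o in_alg L)).
Qed.

(** Multiplication by x acts on the functions on the set of embeddings as a
diagonal matrix.  The matrix V of the values of the embeddings at a basis
conjugates it to the matrix of multiplication by x; V is invertible because the
conjugates of t are distinct, by the Vandermonde determinant. *)
Lemma trace_embeddings :
  exists fs : 'I_(\dim {:L}) -> {rmorphism L -> algC},
    forall x, ratr (field_trace x) = \sum_i fs i x.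
Proof.
have [t tL] := primitive_element; set n := \dim {:L}.
have /polyOver1P[p pE] := minPolyOver 1%AS t.
have szp : size p = n.+1.
  rewrite -(size_map_poly (in_alg L)) -pE size_minPoly /n -tL.
  by rewrite dim_Fadjoin dimv1 muln1.
have p_monic : p \is monic by rewrite -(map_monic (in_alg L)) -pE monic_minPoly.
have p_sep : separable_poly p.
  rewrite -(separable_map (in_alg L)) -pE.
  exact: separable_element_rat.
have [r rE] := closed_field_poly_normal (map_poly ratr p : {poly algC}).
rewrite lead_coef_map (monicP p_monic) rmorph1 scale1r in rE.
have szr : size r = n.
  by apply/succn_inj; rewrite -(size_prod_XsubC r id) -rE size_map_poly szp.
have uniq_r : uniq r by rewrite -separable_prod_XsubC -rE separable_map.
have /choice[fs fsE] (i : 'I_n) :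
    exists f : {rmorphism L -> algC}, f t = r`_i.
  apply: embedding_of_root tL (esym pE) _.
  by rewrite rE root_prod_XsubC mem_nth // szr.
exists fs => x.
set b := vbasis {:L}; have bB : basis_of {:L} b := vbasisP _.
pose V := \matrix_(i < n, j < n) fs i b`_j.
have V_unit : V \in unitmx.
  rewrite unitmxE unitfE; apply/det0P => -[v v0 vV].
  have vfs y : \sum_i v 0 i * fs i y = 0.
    rewrite (coord_basis bB (memvf y)).
    under eq_bigr do rewrite raddf_sum mulr_sumr.
    rewrite exchange_big big1 //= => j _.
    under eq_bigr do rewrite embedding_alg mulrCA.
    rewrite -mulr_sumr; move/rowP/(_ j): vV; rewrite !mxE.
    by under eq_bigr do rewrite mxE; move=> ->; rewrite mulr0.
  pose W := Vandermonde n (\row_i r`_i : 'rV[algC]_n).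
  have : W^T \in unitmx.
    rewrite unitmxE det_tr det_Vandermonde unitfE.
    apply/prodf_neq0 => i _; apply/prodf_neq0 => j ij.
    by rewrite !mxE subr_eq0 nth_uniq ?szr // gt_eqF.
  move=> /mulmxK/(_ v) WK; case/negP: v0; rewrite -WK.
  suff -> : v *m W^T = 0 by rewrite mul0mx.
  apply/rowP => k; rewrite !mxE -[RHS](vfs (t ^+ k)); apply: eq_bigr => i _.
  by rewrite !mxE rmorphXn fsE.
set A := mxof b b (amull x).
(* Row i is the multiplicativity of the embedding i on x times the basis. *)
have AV : diag_mx (\row_i fs i x) *m V = V *m (map_mx ratr A)^T.
  apply/matrixP => i j; rewrite mul_diag_mx !mxE -rmorphM /=.
  rewrite [x * _](coord_basis bB (memvf _)) rmorph_sum; apply: eq_bigr => k _.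
  rewrite embedding_alg mulrC !mxE /=.
  by rewrite vecof_delta lfunE.
have /(congr1 mxtrace) :
    diag_mx (\row_i fs i x) = V *m (map_mx ratr A)^T *m invmx V.
  by rewrite -AV mulmxK.
rewrite mxtrace_mulC mulKmx // mxtrace_tr mxtrace_diag => trE.
rewrite /field_trace -/A /mxtrace rmorph_sum /=.
transitivity (\tr (map_mx ratr A : 'M[algC]_n)); last first.
  by rewrite -trE; apply: eq_bigr => i _; rewrite !mxE.
by apply: eq_bigr => i _; rewrite !mxE.
Qed.

End Embeddings.

Section TraceForm.
Variable L : fieldExtType rat.
Implicit Types (f : {rmorphism L -> algC}) (x : L).

Lemma traceZ (a : rat) x : field_trace (a *: x) = a * field_trace x.
Proof. exact: (linearZ_LR (@field_trace L)). Qed.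

Lemma trace_sum (I : finType) (F : I -> L) :
  field_trace (\sum_i F i) = \sum_i field_trace (F i).
Proof. exact: (raddf_sum (@field_trace L)). Qed.

Lemma traceD x y : field_trace (x + y) = field_trace x + field_trace y.
Proof. exact: (raddfD (@field_trace L)). Qed.

Lemma embedding_exists : inhabited {rmorphism L -> algC}.
Proof.
have [fs _] := trace_embeddings L.
by constructor; apply: fs (Ordinal (adim_gt0 {:L})).
Qed.

Lemma trace_gt0 x : (forall f, 0 < f x) -> 0 < field_trace x.
Proof.
move=> fx; have [fs fsE] := trace_embeddings L.
rewrite -(ltr0q algC) fsE (bigD1 (Ordinal (adim_gt0 {:L}))) //=.
by rewrite ltr_wpDr ?fx // sumr_ge0 // => i _; rewrite ltW ?fx.
Qed.

Lemma trace_eq0 x : (forall f, (f x)^* = - f x) -> field_trace x = 0.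
Proof.
move=> fx; have [fs fsE] := trace_embeddings L.
have : (ratr (field_trace x))^* = - ratr (field_trace x) :> algC.
  by rewrite fsE rmorph_sum -sumrN; apply: eq_bigr => i _; apply: fx.
rewrite fmorph_rat => /eqP; rewrite -addr_eq0 -mulr2n mulrn_eq0 /=.
by rewrite fmorph_eq0 => /eqP.
Qed.

Lemma trace_int x : (forall f, f x \in Aint) -> field_trace x \in Num.int.
Proof.
move=> fx; have [fs fsE] := trace_embeddings L.
have /intrP[z zE] : (ratr (field_trace x) : algC) \in Num.int.
  apply: Cint_rat_Aint; first exact: Crat_rat.
  by rewrite fsE; apply: rpred_sum => i _; apply: fx.
suff -> : field_trace x = z%:~R by rewrite rpred_int.
apply: (fmorph_inj (ratr : {rmorphism rat -> algC})).
by rewrite [LHS]zE [RHS]ratr_int.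
Qed.

Lemma trace_basis m (b : m.-tuple L) x : basis_of {:L} b ->
  field_trace x = \sum_(i < m) coord b i (x * b`_i).
Proof.
move=> bB; move: b bB (size_basis bB) => b + mE; case: _ / mE b => b bB.
have vB := vbasisP {:L}; set v := vbasis _ in vB *.
rewrite /field_trace -/v.
have -> : mxof v v (amull x) = mxof v b \1 *m mxof b b (amull x) *m mxof b v \1.
  by rewrite -!mxof_comp // comp_lfun1l comp_lfun1r.
rewrite mxtrace_mulC mulmxA -mxof_comp // comp_lfun1l mxof1 ?(basis_free bB) //.
rewrite mul1mx; apply: eq_bigr => i _.
by rewrite !mxE /= vecof_delta lfunE.
Qed.

Lemma trace1 : field_trace (1 : L) = (\dim {:L})%:R.
Proof.
rewrite (trace_basis _ (vbasisP _)).
under eq_bigr => i _ do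
  rewrite mul1r coord_free ?eqxx ?(basis_free (vbasisP _)) //.
by rewrite sumr_const card_ord.
Qed.

(** The trace form is nondegenerate, as Tr(x x^-1) is the degree. *)
Lemma zdisc_neq0 (b : (\dim {:L}).-tuple L) : basis_of {:L} b -> zdisc b != 0.
Proof.
move=> bB; apply/det0P => -[v v0 vM].
pose x := vecof b v; have x0 : x != 0 by rewrite vecof_eq0.
have xy0 y : field_trace (x * y) = 0.
  rewrite (coord_basis bB (memvf y)) mulr_sumr trace_sum big1 // => j _.
  rewrite -scalerAr traceZ; move/rowP/(_ j): vM; rewrite !mxE => vj.
  rewrite (_ : field_trace (x * b`_j) = 0) ?mulr0 //; rewrite -[RHS]vj.
  rewrite /x /vecof mulr_suml trace_sum; apply: eq_bigr => i _.
  by rewrite mxE -scalerAl traceZ !(tnth_nth 0).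
have := xy0 x^-1; rewrite divff // trace1 => /eqP.
by rewrite pnatr_eq0 gtn_eqF // adim_gt0.
Qed.

(** The image of O is a subring of the algebraic numbers with a finite integral
spanning family. *)
Lemma order_Aint (O : {pred L}) x f : is_order O -> x \in O -> f x \in Aint.
Proof.
move=> [Oring [b [_ bO]]] xO.
pose S : {pred algC} := [pred z | `[< exists2 y, y \in O & f y = z >]].
have fb : size (map f b) == \dim {:L} by rewrite size_map size_tuple.
apply: (@fin_Csubring_Aint S _ (Tuple fb)); last by apply/asboolP; exists x.
  have [O1 _ OM] := Oring; split=> [|_ _ /asboolP[y yO <-] /asboolP[z zO <-]].
    by apply/asboolP; exists 1; rewrite ?rmorph1.
  by apply/asboolP; exists (y * z); rewrite ?rmorphM ?OM.
move=> z; apply: (iffP (asboolP _)) => [[y /bO[a ->] <-]|[a ->]].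
  exists a; rewrite rmorph_sum; apply: eq_bigr => i _.
  by rewrite rmorphMz (nth_map 0) ?size_tuple.
exists (\sum_(i < \dim {:L}) b`_i *~ a i); first by apply/bO; exists a.
rewrite rmorph_sum; apply: eq_bigr => i _.
by rewrite rmorphMz (nth_map 0) ?size_tuple.
Qed.

End TraceForm.

(** * Z-bases of an order adapted to a subspace *)

Lemma intspan_trans (V : zmodType) m n (b : m.-tuple V) (c : n.-tuple V)
    (U : 'M[int]_(n, m)) x :
  (forall i : 'I_n, c`_i = \sum_(k < m) b`_k *~ U i k) ->
  inIntSpan c x -> inIntSpan b x.
Proof.
move=> cE [a ->]; exists [ffun k => \sum_i U i k * a i].
under eq_bigr do rewrite cE mulrz_suml.
rewrite exchange_big; apply: eq_bigr => k _ /=.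
rewrite ffunE mulrz_sumr.
by apply: eq_bigr => i _; rewrite mulrzA.
Qed.

Section AdaptedBasis.
Variable L : fieldExtType rat.
Local Notation n := (\dim {:L}).
Implicit Types (O : {pred L}) (b : n.-tuple L).

Definition unimodular_tuple b (U : 'M[int]_n) : n.-tuple L :=
  [tuple \sum_(k < n) b`_k *~ U i k | i < n].

Lemma unimodular_tupleE b U (i : 'I_n) :
  (unimodular_tuple b U)`_i = \sum_(k < n) b`_k *~ U i k.
Proof. by rewrite -tnth_nth tnth_mktuple. Qed.

Lemma unimodular_tupleK b U : U \in unitmx ->
  forall k : 'I_n, b`_k = \sum_(i < n) (unimodular_tuple b U)`_i *~ invmx U k i.
Proof.
move=> Uu k; under eq_bigr do rewrite unimodular_tupleE mulrz_suml.
rewrite exchange_big /=.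
transitivity (\sum_(j < n) b`_j *~ (invmx U *m U) k j).
  rewrite mulVmx // (bigD1 k) //= big1 ?addr0 => [|j /negPf jk].
    by rewrite mxE eqxx.
  by rewrite mxE eq_sym jk.
apply: eq_bigr => j _; rewrite mxE mulrz_sumr.
by apply: eq_bigr => i _; rewrite mulrC mulrzA.
Qed.

Lemma zbasis_unimodular O b U :
  U \in unitmx -> is_zbasis O b -> is_zbasis O (unimodular_tuple b U).
Proof.
move=> Uu [bB bO]; split=> [|x]; last first.
  rewrite bO; split; last exact/intspan_trans/unimodular_tupleE.
  exact/intspan_trans/unimodular_tupleK.
rewrite basisEdim size_tuple leqnn andbT; apply/subvP => x _.
rewrite (coord_basis bB (memvf x)); apply: rpred_sum => k _; apply: rpredZ.
rewrite (unimodular_tupleK b Uu); apply: rpred_sum => i _; apply: rpredMz.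
by rewrite memv_span // mem_nth // size_tuple.
Qed.

(** The Smith form of the (scaled) matrix of a linear map with kernel V: after a
unimodular change of basis the image of an integer vector vanishes exactly when
its coordinates outside the null rows do, so the basis vectors of the null rows
Z span V. *)
Lemma saturated_coordinates (V : {vspace L}) b : basis_of {:L} b ->
  exists2 U : 'M[int]_n, U \in unitmx & exists Z : pred 'I_n,
    (forall i, Z i -> (unimodular_tuple b U)`_i \in V) /\
    forall a : 'I_n -> rat, \sum_i a i *: (unimodular_tuple b U)`_i \in V ->
      forall i, ~~ Z i -> a i = 0.
Proof.
move=> bB; pose f : 'End(L) := (\1 - projv V)%VF.
have fV x : (x \in V) = (f x == 0).
  rewrite !lfunE /= !lfunE /= subr_eq0; apply/idP/eqP => [xV|->].
    by rewrite projv_id.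
  exact: memv_proj.
have [N N0 [B NB]] := common_denominator (mxof b b f).
have [M Mu [R Ru [d _ BE]]] := int_Smith_normal_form B.
exists (invmx M); first by rewrite unitmx_inv.
set c := unimodular_tuple _ _.
have N0' : N%:~R != 0 :> rat by rewrite intr_eq0 gt_eqF.
have fc (a : 'I_n -> rat) :
    N%:~R *: rVof b (f (\sum_i a i *: c`_i)) =
    (\row_i (a i * (d`_i)%:~R)) *m map_mx intr R.
  have -> : \sum_i a i *: c`_i =
      vecof b ((\row_i a i) *m map_mx intr (invmx M)).
    rewrite /vecof; under eq_bigr do rewrite unimodular_tupleE scaler_sumr.
    rewrite exchange_big; apply: eq_bigr => k _ /=.
    rewrite !mxE scaler_suml; apply: eq_bigr => i _.
    by rewrite !mxE -scaler_int scalerA.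
  rewrite -mul_mxof scalemxAr NB -mulmxA -map_mxM BE !mulmxA mulVmx // mul1mx.
  rewrite map_mxM mulmxA; congr (_ *m _); apply/rowP => j.
  rewrite !mxE (bigD1 j) //= big1 ?addr0 => [|i /negPf ij].
    by rewrite !mxE eqxx.
  by rewrite !mxE (ij : (i == j :> nat) = false) mulr0.
have cV (a : 'I_n -> rat) : \sum_i a i *: c`_i \in V <->
    forall i, a i * (d`_i)%:~R = 0.
  rewrite fV -(rVof_eq0 bB) -(inj_eq (scalerI N0')) scaler0 fc; split.
    move=> /eqP aR i; have R'u := map_intr_unitmx Ru.
    move: (mulmxK R'u (\row_i (a i * (d`_i)%:~R))); rewrite aR mul0mx.
    by move/rowP/(_ i); rewrite !mxE.
  move=> ad; apply/eqP; rewrite [X in X *m _](_ : _ = 0) ?mul0mx //.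
  by apply/rowP => i; rewrite !mxE ad.
exists (fun i => d`_i == 0); split=> [i /eqP di|a /cV aV i /negPf di].
  have -> : c`_i = \sum_j (j == i)%:R *: c`_j.
    rewrite (bigD1 i) //= eqxx scale1r big1 ?addr0 // => j /negPf ->.
    by rewrite scale0r.
  apply/cV => j; have [->|_] := eqVneq j i; last by rewrite mul0r.
  by rewrite di mulr0.
by have /eqP := aV i; rewrite mulf_eq0 intr_eq0 di orbF => /eqP.
Qed.

(** A subspace meets an order in a direct summand. *)
Lemma adapted_zbasis O (V : {vspace L}) : is_order O ->
  exists2 c : n.-tuple L, is_zbasis O c & basis_of V (take (\dim V) c).
Proof.
move=> [_ [b bO]]; have [bB _] := bO.
have [U Uu [Z [ZV nZ]]] := saturated_coordinates V bB.
set c0 := unimodular_tuple b U in ZV nZ.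
have [c0B _] : is_zbasis O c0 by apply: zbasis_unimodular.
pose eZ := [seq i <- enum 'I_n | Z i].
pose e := eZ ++ [seq i <- enum 'I_n | ~~ Z i].
have e_perm : perm_eq e (enum 'I_n) by apply/permPl/perm_filterC.
have sz_e : size e == n by rewrite (perm_size e_perm) size_enum_ord.
have s_inj : injective (tnth (Tuple sz_e)).
  apply/tuple_uniqP; rewrite (perm_uniq e_perm); exact: enum_uniq.
pose c := unimodular_tuple b (row_perm (perm s_inj) U).
have cO : is_zbasis O c.
  by apply: zbasis_unimodular; rewrite // row_permE unitmx_mul unitmx_perm.
have cE : c = map (fun i : 'I_n => c0`_i) e :> seq L.
  apply: (@eq_from_nth _ 0) => [|i].
    by rewrite size_tuple size_map (eqP sz_e).
  rewrite size_tuple.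
  move=> lt_i; have -> : i = Ordinal lt_i by [].
  rewrite (nth_map (Ordinal lt_i)) ?(eqP sz_e) // !unimodular_tupleE.
  by apply: eq_bigr => k _; rewrite mxE permE (tnth_nth (Ordinal lt_i)).
have takeE : take (size eZ) c = map (fun i : 'I_n => c0`_i) eZ.
  by rewrite cE -map_take take_size_cat.
suff VB : basis_of V (take (size eZ) c).
  exists c => //; suff -> : \dim V = size eZ by [].
  have sz : size (take (size eZ) c) == size eZ by rewrite takeE size_map.
  exact: (@size_basis _ _ _ (size eZ) (Tuple sz)).
rewrite basisEfree; apply/and3P; split.
- have := basis_free cO.1; rewrite -{1}(cat_take_drop (size eZ) c).
  exact: catl_free.
- apply/span_subvP => x; rewrite takeE => /mapP[i].
  by rewrite mem_filter => /andP[Zi _] ->; apply: ZV.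
rewrite takeE size_map -(size_map (fun i : 'I_n => c0`_i)).
apply: leq_trans (dim_span _); apply: dimvS; apply/subvP => x xV.
have xE := coord_basis c0B (memvf x).
rewrite xE; apply: rpred_sum => i _; have [Zi|nZi] := boolP (Z i).
  apply/rpredZ/memv_span/mapP; exists i => //.
  by rewrite mem_filter Zi mem_enum.
by rewrite (nZ (fun j => coord c0 j x)) ?scale0r ?mem0v // -xE.
Qed.

(** By freeness, the coordinates of x beyond k vanish. *)
Lemma intspan_take k (b : n.-tuple L) x : free b -> (k <= n)%N ->
  x \in <<take k b>>%VS -> inIntSpan b x ->
  exists a : 'I_k -> int, x = \sum_(i < k) b`_i *~ a i.
Proof.
move=> bfree le_kn xk [a xE]; exists (fun i => a (widen_ord le_kn i)).
have a0 (i : 'I_n) : (k <= i)%N -> a i = 0.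
  move=> le_ki; suff : x \in lker (linfun (coord b i : L -> rat^o)).
    rewrite memv_ker lfunE /= xE; under eq_bigr do rewrite -scaler_int.
    by rewrite coord_sum_free // intr_eq0 => /eqP.
  apply: (subvP (_ : (<<take k b>> <= _)%VS)) xk; apply/span_subvP => y.
  move=> /(nthP 0)[j]; rewrite size_takel ?size_tuple // => lt_jk <-.
  rewrite memv_ker lfunE /= nth_take //.
  have lt_jn := leq_trans lt_jk le_kn.
  rewrite -[j]/(val (Ordinal lt_jn)) coord_free // (_ : (_ == i) = false) //.
  by apply/negbTE; rewrite -val_eqE /= ltn_eqF // (leq_trans lt_jk).
rewrite xE (bigID (fun i : 'I_n => (i < k)%N)) /= [X in _ + X]big1 => [|i].
  by rewrite addr0 (big_ord_narrow le_kn).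
by rewrite -leqNgt => /a0 ->.
Qed.

End AdaptedBasis.

Lemma order_sum (L : fieldExtType rat) (O : {pred L}) (I : finType)
    (F : I -> L) (a : I -> int) :
  is_order O -> (forall i, F i \in O) -> \sum_i F i *~ a i \in O.
Proof.
move=> [[O1 OB OM] _] FO.
have Oz : zmod_closed O by split=> //; rewrite -(subrr 1) OB.
pose Om := GRing.isZmodClosed.Build _ _ Oz.
pose Oc : zmodClosed L := HB.pack O Om.
by apply: (@rpred_sum _ Oc) => i _; apply: (@rpredMz _ Oc).
Qed.

Lemma zbasis_mem (L : fieldExtType rat) (O : {pred L})
    (b : (\dim {:L}).-tuple L) (i : 'I_(\dim {:L})) :
  is_zbasis O b -> b`_i \in O.
Proof.
move=> [_ bO]; apply/bO; exists [ffun j => (j == i)%:Z].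
rewrite (bigD1 i) //= ffunE eqxx big1 ?addr0 // => j /negPf ji.
by rewrite ffunE ji.
Qed.

Lemma subfield_is_order (L : fieldExtType rat) (F : {subfield L}) O :
  is_order O -> is_order (subfield_order F O).
Proof.
move=> Oord; have [[O1 OB OM] _] := Oord.
have [c [cB cO] FB] := adapted_zbasis F Oord.
split.
  split=> [|x y xO yO|x y xO yO]; rewrite !inE /=.
  - by rewrite algid1.
  - exact: OB.
  exact: OM.
have le_k : (\dim F <= \dim {:L})%N by rewrite dimvS ?subvf.
have sz : size (map (vsproj F) (take (\dim F) c)) == \dim {:subvs_of F}.
  by rewrite size_map size_takel ?size_tuple // dimvf.
have cF i : (i < \dim F)%N -> c`_i \in F.
  move=> lt_i; apply: (basis_mem FB); rewrite -(nth_take 0 lt_i).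
  by rewrite mem_nth // size_takel ?size_tuple.
have nthE i : (i < \dim F)%N -> vsval (Tuple sz)`_i = c`_i.
  move=> lt_i; rewrite (nth_map 0) ?size_takel ?size_tuple // nth_take //.
  by rewrite vsprojK ?cF.
have dimF : \dim {:subvs_of F} = \dim F by rewrite dimvf.
exists (Tuple sz); split=> [|x].
  rewrite basisEdim size_tuple leqnn andbT; apply/subvP => x _.
  rewrite -(vsvalK x) -[vsproj F _]lfunE /=.
  rewrite (_ : map _ _ = map (linfun (vsproj F)) (take (\dim F) c)); last first.
    by apply: eq_map => y; rewrite lfunE.
  by rewrite -limg_span memv_img // (span_basis FB) subvsP.
rewrite inE /= cO; split=> [xc|[a ->]].
  have xF : vsval x \in <<take (\dim F) c>>%VS.
    by rewrite (span_basis FB) subvsP.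
  have [a aE] := intspan_take (basis_free cB) le_k xF xc.
  exists [ffun i => a (cast_ord dimF i)]; apply: val_inj.
  rewrite /= aE linear_sum /= (reindex (cast_ord dimF)) /=; last first.
    by exists (cast_ord (esym dimF)) => i _; rewrite ?cast_ordK ?cast_ordKV.
  apply: eq_bigr => i _ /=; rewrite ffunE raddfMz /=.
  by rewrite -[in LHS]nthE ?(leq_trans (ltn_ord i)) ?dimF.
apply/cO; rewrite linear_sum /=; under eq_bigr do rewrite raddfMz.
apply: (order_sum a Oord) => i.
rewrite [_ _`_i]nthE -?dimF //.
have lt_i : (i < \dim {:L})%N by rewrite (leq_trans (ltn_ord i)) ?dimF.
exact: (zbasis_mem (Ordinal lt_i) (conj cB cO)).
Qed.

(** * Quadratic extensions of totally real fields *)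

Lemma sqr_ge0_real (z : algC) : 0 <= z ^+ 2 -> z \is Num.real.
Proof.
move=> z2; have /eqP := sqrtCK (z ^+ 2); rewrite eqf_sqr.
have w : sqrtC (z ^+ 2) \is Num.real by rewrite ger0_real ?sqrtC_ge0.
by case/orP => /eqP wE; [rewrite -wE | rewrite -[z]opprK -wE rpredN].
Qed.

Lemma sqr_lt0_conj (z : algC) : z ^+ 2 < 0 -> z^* = - z.
Proof.
move=> z2; have : (z^*) ^+ 2 == z ^+ 2.
  by rewrite -rmorphXn /= (CrealP (ltr0_real z2)).
rewrite eqf_sqr => /orP[/eqP/CrealP zr|/eqP //].
by have := real_exprn_even_ge0 zr (isT : ~~ odd 2); rewrite (lt_geF z2).
Qed.

Section Subfields.
Variable L : fieldExtType rat.
Implicit Types (F : {subfield L}) (f : {rmorphism L -> algC}).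

Lemma totally_real_sub F f x :
  totally_real (subvs_of F) -> x \in F -> f x \is Num.real.
Proof. by move=> Fr xF; have := Fr (f \o vsval) (Subvs xF). Qed.

Lemma totally_real_trace_gt0 (x : L) :
  totally_real L -> x != 0 -> 0 < field_trace (x ^+ 2).
Proof.
move=> Lr x0; apply: trace_gt0 => f.
by rewrite rmorphXn real_exprn_even_gt0 //= fmorph_eq0.
Qed.

(** Q(mu^2) is F because 3 is prime; thus Q(mu) strictly contains the cubic
field F inside a sextic field. *)
Lemma adjoin_root_full F mu : \dim F = 3%N -> \dim {:L} = 6%N ->
  mu ^+ 2 \in F -> mu \notin F -> mu ^+ 2 \notin 1%VS ->
  <<1; mu>>%VS = {:L}%VS.
Proof.
move=> dF dL mu2F muF mu2Q.
pose D := <<1; mu ^+ 2>>%AS; pose E := <<1; mu>>%AS.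
have DF : (D <= F)%VS by apply/FadjoinP; rewrite sub1v.
have DE : (D <= E)%VS.
  by apply/FadjoinP; rewrite subv_adjoin rpredX // memv_adjoin.
have dD : \dim D = 3%N.
  have : (\dim D %| 3)%N by rewrite -dF field_dimS.
  rewrite dvdn_divisors // !inE => /orP[/eqP dD|/eqP //].
  have /eqP D1 : (1 == D)%VS by rewrite eqEdim sub1v dimv1 dD.
  by case/negP: mu2Q; rewrite D1 memv_adjoin.
have FE : (F <= E)%VS.
  suff -> : (F : {vspace L}) = D by [].
  by apply/esym/eqP; rewrite eqEdim DF dF dD.
have : (\dim E %| 6)%N by rewrite -dL field_dimS // subvf.
have : (3 %| \dim E)%N by rewrite -dF field_dimS.
rewrite [in X in _ -> X -> _]dvdn_divisors // !inE => d3 /or4P[]/eqP dE;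
  rewrite ?dE // in d3.
  case/negP: muF; suff -> : (F : {vspace L}) = E by apply: memv_adjoin.
  by apply/eqP; rewrite eqEdim FE dE dF.
by apply/eqP; rewrite eqEdim subvf dE dL.
Qed.

Lemma dim_adjoin_sqrt (x : L) : x ^+ 2 \in 1%VS -> (\dim <<1; x>> <= 2)%N.
Proof.
move=> x2; rewrite dim_Fadjoin dimv1 muln1 -ltnS -size_minPoly.
have /vlineP[a aE] := x2.
have -> : 3%N = size ('X^2 - (a%:A)%:P : {poly L}) by rewrite size_XnsubC.
apply: dvdp_leq; first by rewrite -size_poly_gt0 size_XnsubC.
apply: minPoly_dvdp.
  by rewrite rpredB ?rpredX ?polyOverX // polyOverC -aE.
by rewrite rootE !hornerE aE subrr.
Qed.

(** A square root of a rational has degree at most 2, which must divide 3. *)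
Lemma cubic_sqr_rational (x : L) :
  \dim {:L} = 3%N -> x ^+ 2 \in 1%VS -> x \in 1%VS.
Proof.
move=> dL /dim_adjoin_sqrt le2.
have : (\dim <<1; x>> %| 3)%N by rewrite -dL field_dimS // subvf.
rewrite dvdn_divisors // !inE => /orP[]/eqP dE; last by rewrite dE in le2.
have /eqP -> : (1 == <<1; x>>)%VS by rewrite eqEdim sub1v dimv1 dE.
exact: memv_adjoin.
Qed.

Definition mulv (s : L) F : {vspace L} := (amull s @: F)%VS.

Lemma mulvP s F x : reflect (exists2 a, a \in F & x = s * a) (x \in mulv s F).
Proof.
by apply: (iffP memv_imgP) => -[a aF ->]; exists a; rewrite ?lfunE.
Qed.

Lemma dim_mulv s F : s != 0 -> \dim (mulv s F) = \dim F.
Proof.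
move=> s0; apply: limg_dim_eq; apply/eqP; rewrite -subv0; apply/subvP => x.
rewrite memv_cap memv_ker lfunE /= mulf_eq0 (negPf s0) memv0.
by case/andP.
Qed.

Lemma quadratic_decomposition F s x :
  \dim {:L} = (\dim F * 2)%N -> s \notin F ->
  exists p m, [/\ p \in F, m \in mulv s F & x = p + m].
Proof.
move=> dL sF; have s0 : s != 0 by apply: contraNneq sF => ->; apply: mem0v.
have cap0 : (F :&: mulv s F = 0)%VS.
  apply/eqP; rewrite -subv0; apply/subvP => y; rewrite memv_cap memv0.
  case/andP => yF /mulvP[a aF yE]; apply: contraNT sF => y0.
  have a0 : a != 0 by apply: contraNneq y0 => a0; rewrite yE a0 mulr0.
  by rewrite -(mulfK a0 s) -yE rpred_div.
have /memv_addP[p pF [m mV xE]] : x \in (F + mulv s F)%VS.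
  suff -> : (F + mulv s F = {:L})%VS by apply: memvf.
  apply/eqP; rewrite eqEdim subvf (dimv_disjoint_sum cap0) dim_mulv //.
  by rewrite dL muln2 addnn leqnn.
by exists p, m.
Qed.

(** Completing the square in t^2 = a + t b; doubling keeps the coefficients in F
free of fractions. *)
Lemma quadratic_generator F : \dim {:L} = (\dim F * 2)%N ->
  exists2 s, s \notin F & s ^+ 2 \in F.
Proof.
move=> dL; have [t tF] : exists t, t \notin F.
  apply/not_existsP => Ft; have : ({:L} <= F)%VS.
    by apply/subvP => x _; apply: contraT => /Ft.
  by move/dimvS; rewrite dL leqNgt ltn_Pmulr // adim_gt0.
have [a [m [aF /mulvP[b bF ->] tE]]] := quadratic_decomposition (t ^+ 2) dL tF.
exists (2 * t - b).
  apply: contra tF => sF; have : (2^-1 : rat) *: (2 * t) \in F.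
    by rewrite rpredZ // -[2 * t](subrK b) rpredD.
  by rewrite mulr_natl -scaler_nat scalerA mulVf // scale1r.
suff -> : (2 * t - b) ^+ 2 = 4 * a + b ^+ 2.
  by rewrite rpredD ?rpredM ?rpredX ?rpred_nat.
have -> : a = t ^+ 2 - t * b by rewrite tE addrK.
ring.
Qed.

(** The conjugates of mu are the square roots of one negative rational. *)
Lemma imaginary_quadratic_adjoin (mu : L) :
  mu ^+ 2 \in 1%VS -> (forall f, f mu ^+ 2 < 0) ->
  imaginary_quadratic (subvs_of <<1; mu>>%AS).
Proof.
move=> mu2 fmu; have [f0] := embedding_exists L; split.
  rewrite dimvf -[dim _]/(\dim <<1; mu>>).
  apply/eqP; rewrite eqn_leq dim_adjoin_sqrt //.
  rewrite ltn_neqAle adim_gt0 andbT; apply/negP => /eqP dE.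
  have /eqP E1 : (1 == <<1; mu>>)%VS by rewrite eqEdim sub1v dimv1 -dE.
  have : mu \in 1%VS by rewrite E1 memv_adjoin.
  case/vlineP => a aE; have := fmu f0.
  rewrite aE embedding_alg rmorph1 mulr1 -rmorphXn /= ltrq0.
  by rewrite ltNge sqr_ge0.
move=> g; exists (Subvs (memv_adjoin 1 mu)); apply/negP => gr.
have /vlineP[a aE] := mu2.
have a0 : a < 0.
  by have := fmu f0; rewrite -rmorphXn aE embedding_alg rmorph1 mulr1 ltrq0.
have : 0 <= g (Subvs (memv_adjoin 1 mu)) ^+ 2 by rewrite real_exprn_even_ge0.
rewrite -rmorphXn.
have -> : Subvs (memv_adjoin 1 mu) ^+ 2 = a%:A.
  by apply: val_inj; rewrite /= algid1 -aE.
by rewrite embedding_alg rmorph1 mulr1 ler0q leNgt a0.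
Qed.

(** If f(s)^2 were nonnegative, f(s) would be real and so would f on all of
F + s F, against the hypothesis that L is totally imaginary. *)
Lemma CM_fieldP : CM_field L -> \dim {:L} = 6%N ->
  exists F s, [/\ \dim F = 3%N, totally_real (subvs_of F), s \notin F,
    s ^+ 2 \in F & forall f, f s ^+ 2 < 0].
Proof.
move=> [Lim [F [Fr dLF]]] dL.
have dF : \dim {:L} = (\dim F * 2)%N.
  have /divnK := field_dimS (subvf F); rewrite dLF => <-.
  by rewrite mulnC.
have [s sF s2F] := quadratic_generator dF.
have dF3 : \dim F = 3%N.
  by apply/eqP; rewrite -(@eqn_pmul2r 2) // -dF dL.
exists F, s; split=> // f.
have s2r : f s ^+ 2 \is Num.real by rewrite -rmorphXn (totally_real_sub f Fr).
rewrite real_ltNge ?real0 //; apply/negP => /sqr_ge0_real sr.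
have [x /negP[]] := Lim f.
have [p [_ [pF /mulvP[a aF ->] ->]]] := quadratic_decomposition x dF sF.
rewrite rmorphD rmorphM /=; apply: rpredD; first exact: totally_real_sub.
by apply: rpredM => //; apply: totally_real_sub.
Qed.

End Subfields.

(** * The discriminant and the imaginary elements *)

Definition gram (L : fieldExtType rat) k (c : seq L) : 'M[rat]_k :=
  \matrix_(i, j) field_trace (c`_i * c`_j).

Section Gram.
Variable L : fieldExtType rat.
Implicit Types (c : seq L) (O : {pred L}).

Lemma zdisc_gram k (c : (\dim {:L}).-tuple L) : \dim {:L} = k ->
  zdisc c = \det (gram k c).
Proof.
by move=> <-; congr (\det _); apply/matrixP => i j; rewrite !mxE !(tnth_nth 0).
Qed.

Lemma qform_gram k c u :
  qform (gram k c) u = field_trace ((\sum_(i < k) u 0 i *: c`_i) ^+ 2).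
Proof.
rewrite /qform mxE expr2 mulr_sumr trace_sum; apply: eq_bigr => j _.
rewrite !mxE mulr_suml mulr_suml trace_sum; apply: eq_bigr => i _.
by rewrite !mxE -scalerAl -scalerAr !traceZ mulrA mulrAC.
Qed.

Lemma gram_tr k c : (gram k c)^T = gram k c.
Proof. by apply/matrixP => i j; rewrite !mxE mulrC. Qed.

Lemma basis_comb (V : {vspace L}) k c (a : 'I_k -> rat) :
  basis_of V (take k c) -> size (take k c) = k ->
  (\sum_i a i *: c`_i \in V) /\
  (\sum_i a i *: c`_i = 0 -> forall i, a i = 0).
Proof.
move=> cV sz; have szT : size (take k c) == k by rewrite sz.
have E : \sum_i a i *: c`_i = \sum_i a i *: (Tuple szT)`_i.
  by apply: eq_bigr => i _; rewrite /= nth_take.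
rewrite E; split.
  apply: rpred_sum => i _; apply/rpredZ/(basis_mem cV).
  by rewrite mem_nth // sz.
by have /freeP := basis_free cV : free (Tuple szT); apply.
Qed.

(** F and s F are orthogonal for the trace form, since a product of a real and
an imaginary element is imaginary and has trace 0.  This is why clearing the
imaginary parts of the last r basis vectors splits the Gram matrix; the integer
z is the determinant of the matrix 2 Tr(p_i p_j). *)
Lemma discriminant_split O (F : {subfield L}) (s : L) r
    (c : (\dim {:L}).-tuple L) :
  \dim {:L} = (r + r)%N -> \dim F = r -> s \notin F ->
  (forall (f : {rmorphism L -> algC}) x, x \in F -> f x \is Num.real) ->
  (forall (f : {rmorphism L -> algC}), f s ^+ 2 < 0) ->
  is_order O -> is_zbasis O c -> basis_of (mulv s F) (take r c) ->
  exists2 z : int, z != 0 &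
    order_disc O = (-1) ^+ r * \det (- (1 / 2) *: gram r c) * z%:~R.
Proof.
move=> dL dF sF Fr fs Oord cO cV; have [cB _] := cO.
have dL2 : \dim {:L} = (\dim F * 2)%N by rewrite dL dF muln2 addnn.
have szk : size (take r c) = r by rewrite size_takel // size_tuple dL leq_addr.
have conjF (f : {rmorphism L -> algC}) x : x \in F -> (f x)^* = f x.
  by move=> /(Fr f)/CrealP.
have conjV (f : {rmorphism L -> algC}) x : x \in mulv s F -> (f x)^* = - f x.
  move=> /mulvP[a aF ->].
  by rewrite !rmorphM /= (sqr_lt0_conj (fs f)) (conjF f a) // mulNr.
have trFV x y : x \in F -> y \in mulv s F -> field_trace (x * y) = 0.
  move=> xF yV; apply: trace_eq0 => f.
  by rewrite !rmorphM /= conjF ?conjV // mulrN.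
have /choice[p /choice[m pm]] (j : 'I_r) : exists p m,
    [/\ p \in F, m \in mulv s F & c`_(r + j) = p + m].
  exact: quadratic_decomposition.
have pF j : p j \in F by have [] := pm j.
have mV j : m j \in mulv s F by have [] := pm j.
have cpm (j : 'I_r) : c`_(r + j) = p j + m j by have [] := pm j.
have c_lV (i : 'I_r) : c`_i \in mulv s F.
  by apply: (basis_mem cV); rewrite -(nth_take 0 (ltn_ord i)) mem_nth ?szk.
have szT : size (take r c) == r by rewrite szk.
pose A := \matrix_(j < r, i < r) coord (Tuple szT) i (m j).
have mA j : m j = \sum_i A j i *: c`_i.
  rewrite {1}(coord_basis (X := Tuple szT) cV (mV j)).
  by apply: eq_bigr => i _; rewrite mxE /= nth_take.
pose W := gram r c; pose P := \matrix_(i < r, j < r) field_trace (p i * p j).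
(* Subtracting from c_(r+j) its component m_j in s F is unipotent. *)
have gramE : gram (r + r) c =
    block_mx 1%:M 0 A 1%:M *m block_mx W (W *m A^T) 0 P.
  have trm j (i : 'I_r) :
      field_trace (m j * c`_i) = \sum_k A j k * field_trace (c`_k * c`_i).
    rewrite mA mulr_suml trace_sum; apply: eq_bigr => k _.
    by rewrite -scalerAl traceZ.
  rewrite mulmx_block !mul1mx !mul0mx !addr0.
  have trp (j i : 'I_r) : field_trace (p j * c`_i) = 0.
    exact: trFV (pF j) (c_lV i).
  have mW j i : (A *m W) j i = field_trace (m j * c`_i).
    by rewrite trm mxE; apply: eq_bigr => k _; rewrite !mxE.
  have Wm (i j : 'I_r) : (W *m A^T) i j = field_trace (c`_i * m j).
    rewrite mulrC trm mxE; apply: eq_bigr => k _.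
    by rewrite !mxE mulrC [c`_i * _]mulrC.
  have AWA i j : (A *m (W *m A^T)) i j = field_trace (m i * m j).
    rewrite mulmxA [LHS]mxE [in RHS](mA j) mulr_sumr trace_sum.
    by apply: eq_bigr => k _; rewrite mW -scalerAr traceZ [A^T _ _]mxE mulrC.
  rewrite -[LHS]submxK; congr block_mx; apply/matrixP => i j.
  - by rewrite !mxE.
  - by rewrite Wm !mxE /= cpm mulrDr traceD [_ * p j]mulrC trp add0r.
  - by rewrite mW !mxE /= cpm mulrDl traceD trp add0r.
  have -> : drsubmx (gram (r + r) c) i j =
      field_trace (c`_(r + i) * c`_(r + j)) by rewrite !mxE.
  rewrite [RHS]mxE AWA [P _ _]mxE !cpm mulrDl 2!mulrDr !traceD.
  rewrite (trFV _ _ (pF i) (mV j)) [m i * p j]mulrC (trFV _ _ (pF j) (mV i)).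
  by rewrite addr0 add0r addrC.
have detE : order_disc O = \det W * \det P.
  rewrite (order_discE cO) (zdisc_gram c dL) gramE det_mulmx det_lblock.
  by rewrite det_ublock !det1 !mul1r.
(* 2 p_j is the sum of c_(r+j) and its conjugate, so it is integral. *)
have Pint i j : 2 * field_trace (p i * p j) \in Num.int.
  have -> : 2 * field_trace (p i * p j) =
      field_trace (c`_(r + i) * (p j + p j)).
    rewrite cpm [in RHS]mulrDl traceD [m i * _]mulrC.
    rewrite (trFV _ _ _ (mV i)) ?rpredD // [p i * (_ + _)]mulrDr traceD.
    by ring.
  apply: trace_int => f; rewrite rmorphM.
  have cA (k : 'I_r) : f c`_(r + k) \in Aint.
    have lt_k : (r + k < \dim {:L})%N by rewrite dL ltn_add2l.
    exact: (order_Aint _ Oord (zbasis_mem (Ordinal lt_k) cO)).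
  rewrite rpredM // (_ : f _ = f c`_(r + j) + (f c`_(r + j))^*).
    by rewrite rpredD // Aint_aut.
  rewrite cpm !rmorphD /= (conjF f (p j)) // (conjV f (m j)) //.
  by rewrite addrACA subrr addr0.
pose Q := \matrix_(i, j) Num.floor (2 * field_trace (p i * p j)).
have PQ : P = (1 / 2) *: map_mx intr Q.
  apply/matrixP => i j; rewrite !mxE floorK //.
  by rewrite mulrA mul1r mulVf // mul1r.
have half : (-1) ^+ r * (- (1 / 2)) ^+ r = (1 / 2) ^+ r :> rat.
  by rewrite -exprMn mulN1r opprK.
exists (\det Q).
  apply: contraTneq isT => detQ; have /eqP := zdisc_neq0 cB; case.
  by rewrite -(order_discE cO) detE PQ detZ det_map_mx detQ mulr0 mulr0.
by rewrite detE PQ !detZ det_map_mx /= -half; ring.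
Qed.

End Gram.

Lemma short_imaginary (L : fieldExtType rat) (O : {pred L})
    (F : {subfield L}) (s : L) :
  \dim {:L} = 6%N -> \dim F = 3%N -> s \notin F ->
  totally_real (subvs_of F) ->
  (forall (f : {rmorphism L -> algC}), f s ^+ 2 < 0) -> is_order O ->
  exists mu, [/\ mu \in O, mu \in mulv s F, mu != 0 &
    (- (1 / 2) * field_trace (mu ^+ 2)) ^+ 3 <= (4 / 3) ^+ 3 * `|order_disc O|].
Proof.
move=> dL dF sF Fr fs Oord.
have s0 : s != 0 by apply: contraNneq sF => ->; apply: mem0v.
have dV : \dim (mulv s F) = 3%N by rewrite dim_mulv.
have [c cO] := adapted_zbasis (mulv s F) Oord; rewrite dV => cV.
have Fr' (f : {rmorphism L -> algC}) x : x \in F -> f x \is Num.real.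
  exact: totally_real_sub.
have [z z0 discE] := discriminant_split (r := 3) dL dF sF Fr' fs Oord cO cV.
set G := _ *: _ in discE.
have szk : size (take 3 c) = 3%N by rewrite size_takel // size_tuple dL.
have qG u : qform G u =
    - (1 / 2) * field_trace ((\sum_(i < 3) u 0 i *: c`_i) ^+ 2).
  by rewrite -qform_gram /G /qform -scalemxAr -scalemxAl mxE.
have Vpos x : x \in mulv s F -> x != 0 -> 0 < - (1 / 2) * field_trace (x ^+ 2).
  move=> /mulvP[a aF ->] sa0.
  have a0 : a != 0 by apply: contraNneq sa0 => ->; rewrite mulr0.
  rewrite -traceZ; apply: trace_gt0 => f.
  rewrite embedding_alg rmorphXn rmorphM exprMn rmorphN /= nmulr_rgt0.
    rewrite nmulr_rlt0 // real_exprn_even_gt0 ?fmorph_eq0 //.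
    exact: Fr'.
  by rewrite oppr_lt0 ltr0q divr_gt0.
have Gpos : posdef G.
  split=> [|u u0]; first by rewrite /G linearZ /= gram_tr.
  rewrite qG; have [xV x0] := basis_comb (fun i => u 0 i) cV szk.
  apply: Vpos => //; apply: contraNneq u0 => /x0 u0.
  by apply/eqP/rowP => i; rewrite u0 mxE.
have [u u0 uG] := hermite Gpos.
have u0' : map_mx intr u != 0 :> 'rV[rat]_3 by rewrite map_intr_eq0.
exists (\sum_(i < 3) c`_i *~ u 0 i).
have muE : \sum_(i < 3) c`_i *~ u 0 i =
    \sum_(i < 3) (map_mx intr u : 'rV[rat]_3) 0 i *: c`_i.
  by apply: eq_bigr => i _; rewrite mxE scaler_int.
have [xV x0] := basis_comb (fun i => (map_mx intr u : 'rV[rat]_3) 0 i) cV szk.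
split.
- apply: (order_sum _ Oord) => i.
  have lt_i : (i < \dim {:L})%N by rewrite dL (leq_trans (ltn_ord i)).
  exact: (zbasis_mem (Ordinal lt_i) cO).
- by rewrite muE.
- rewrite muE; apply: contraNneq u0' => /x0 ux.
  by apply/eqP/rowP => i; rewrite ux mxE.
rewrite muE -qG; apply: le_trans uG _; rewrite ler_pM2l ?exprn_gt0 //.
have G0 : 0 < \det G by apply: posdef_det.
rewrite discE -mulrA normrMsign normrM (gtr0_norm G0).
by rewrite ler_peMr ?(ltW G0) // -intr_norm ler1z -gtz0_ge1 normr_gt0.
Qed.

(** * CM fields without imaginary quadratic subfield *)

(** From x <= tan x at x = pi / 8, where tan x is the positive root of
t^2 + 2 t = 1, which is less than 9/20. *)
Lemma pi_le (R : realType) : (pi : R) <= 18 / 5.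
Proof.
have pi0 := pi_gt0 R; set x : R := pi / 8.
have x0 : 0 < x by rewrite divr_gt0.
have xpi : x < pi / 2 by rewrite /x; lra.
have cos_gt0 (y : R) : 0 <= y <= x -> 0 < cos y.
  by move=> /andP[y0 yx]; apply: cos_gt0_pihalf; apply/andP; split; lra.
have cosx0 : cos x != 0 by rewrite gt_eqF // cos_gt0 // lexx ltW.
have x_le_tan : x <= tan x.
  have [y /itvP yI||y yI] :=
    @MVT_segment R tan (fun y => (cos y) ^- 2) 0 x (ltW x0).
  - by apply: is_derive_tan; rewrite gt_eqF // cos_gt0 // !ltW ?yI.
  - apply/continuous_in_subspaceT => y /[!(@mem_setE R)] /itvP yI.
    by apply: continuous_tan; rewrite gt_eqF // cos_gt0 // !yI.
  rewrite tan0 !subr0 => ->; rewrite ler_peMl ?(ltW x0) //.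
  have cy : 0 < cos y by apply: cos_gt0; move: yI; rewrite in_itv.
  rewrite -[1]invr1 lef_pV2 ?posrE ?exprn_gt0 //.
  by rewrite expr_le1 ?cos_le1 ?(ltW cy).
have tan2 : tan (x *+ 2) = 1 :> R.
  by rewrite -[RHS](tan_piquarter R) /x -mulr_natr; congr tan; field.
have t1 : tan x ^+ 2 + 2 * tan x = 1.
  move: tan2; rewrite tan_mulr2n // => /eqP.
  have [->|t0] := eqVneq (1 - tan x ^+ 2) 0.
    by rewrite invr0 mulr0 eq_sym oner_eq0.
  by move=> /eqP /(canRL (divfK t0)); lra.
have : x <= 9 / 20 by nra.
by rewrite /x; lra.
Qed.

Lemma cube_root_bound (R : realType) (q D : rat) : 0 <= q ->
  q ^+ 3 <= (4 / 3) ^+ 3 * `|D| ->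
  (ratr q : R) <= (6 / pi) `^ (2 / 3) * `|ratr D| `^ (1 / 3).
Proof.
move=> q0 qD; have pi0 := pi_gt0 R; have pi1 := pi_le R.
have rq0 : 0 <= ratr q :> R by rewrite ler0q.
have rqE : (ratr q : R) = (ratr q ^+ 3) `^ (1 / 3).
  by rewrite -powR_mulrn // -powRrM mul1r mulfV ?pnatr_eq0 // powRr1.
have -> : (6 / pi : R) `^ (2 / 3) = ((6 / pi) ^+ 2) `^ (1 / 3).
  by rewrite -powR_mulrn ?divr_ge0 ?(ltW pi0) // -powRrM mulrA mulr1.
rewrite rqE -powRM ?exprn_ge0 ?normr_ge0 ?divr_ge0 ?(ltW pi0) //.
have le43 : (4 / 3) ^+ 3 <= (6 / pi) ^+ 2 :> R.
  rewrite [leRHS]exprMn [pi^-1 ^+ 2]exprVn ler_pdivlMr ?exprn_gt0 //.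
  have : (pi : R) ^+ 2 <= (18 / 5) ^+ 2.
    by rewrite lerXn2r ?nnegrE ?(ltW pi0) ?divr_ge0.
  lra.
have p6 : 0 <= 6 / pi :> R by rewrite divr_ge0 ?(ltW pi0).
apply: ge0_ler_powR; first by rewrite divr_ge0.
- by rewrite nnegrE exprn_ge0.
- by rewrite nnegrE mulr_ge0 // exprn_ge0.
apply: le_trans (_ : (4 / 3) ^+ 3 * `|ratr D| <= _); last by rewrite ler_wpM2r.
move: qD; rewrite -(ler_rat R) rmorphXn /= rmorphM /= ratr_norm rmorphXn /=.
by rewrite fmorph_div /= !ratr_nat.
Qed.

Lemma CM_without_imaginary_quadratic (R : realType) (K : fieldExtType rat)
    (O : {pred K}) :
  CM_field K -> \dim {:K} = 6%N -> is_order O ->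
  ~ (exists K1 : {subfield K}, imaginary_quadratic (subvs_of K1)) ->
     exists mu : K,
       [/\ mu \in O,
           totally_real_elt (mu ^+ 2),
           <<1; mu>>%VS = {:K}%VS
         & 0 < - (1 / 2) * (ratr (field_trace (mu ^+ 2)) : R)
             <= (6 / pi) `^ (2 / 3) * `|ratr (order_disc O)| `^ (1 / 3)].
Proof.
move=> KCM dK Oord noK1.
have [F [s [dF Fr sF s2F fs]]] := CM_fieldP KCM dK.
have [mu [muO muV mu0 muD]] := short_imaginary dK dF sF Fr fs Oord.
have /mulvP[a aF muE] := muV.
have a0 : a != 0 by apply: contraNneq mu0 => a0; rewrite muE a0 mulr0.
have mu2F : mu ^+ 2 \in F by rewrite muE exprMn rpredM // rpredX.
have muF : mu \notin F.
  by apply: contra sF => muF; rewrite -(mulfK a0 s) -muE rpred_div.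
have fmu (f : {rmorphism K -> algC}) : f mu ^+ 2 < 0.
  rewrite muE rmorphM exprMn /= nmulr_rlt0 ?fs //.
  by rewrite real_exprn_even_gt0 ?fmorph_eq0 // (totally_real_sub f Fr).
exists mu; split=> //.
- by move=> f; apply: totally_real_sub Fr _.
- apply: (adjoin_root_full dF dK mu2F muF); apply/negP => mu2.
  by apply: noK1; exists <<1; mu>>%AS; apply: imaginary_quadratic_adjoin.
have q0 : 0 < - (1 / 2) * field_trace (mu ^+ 2).
  rewrite -traceZ; apply: trace_gt0 => f.
  rewrite embedding_alg rmorphXn rmorphN /= nmulr_rgt0 ?fmu //.
  by rewrite oppr_lt0 ltr0q divr_gt0.
have -> : - (1 / 2) * (ratr (field_trace (mu ^+ 2)) : R) =
    ratr (- (1 / 2) * field_trace (mu ^+ 2)).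
  by rewrite rmorphM rmorphN fmorph_div /= rmorph1 ratr_nat.
by rewrite ltr0q q0 cube_root_bound // ltW.
Qed.

(** * CM fields with an imaginary quadratic subfield *)

(** For a Q-basis v of F, the matrix of multiplication by x in the basis
(v, s v) of L has two copies of the matrix of F on its diagonal. *)
Lemma trace_quadratic (L : fieldExtType rat) (F : {subfield L})
    (x : subvs_of F) :
  \dim {:L} = (\dim F * 2)%N -> field_trace (vsval x) = 2 * field_trace x.
Proof.
move=> dL; have [s sF _] := quadratic_generator dL.
set n := \dim {:subvs_of F}; have dimF : n = \dim F by rewrite /n dimvf.
set v := vbasis {:subvs_of F}; have vB : basis_of {:subvs_of F} v := vbasisP _.
pose v1 := map vsval v; pose v2 := map (fun y => s * vsval y) v.
have sz1 : size v1 = n by rewrite size_map size_tuple.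
have sz : size (v1 ++ v2) == (n + n)%N.
  by rewrite size_cat !size_map !size_tuple.
pose b := Tuple sz.
have bl (i : 'I_n) : b`_(lshift n i) = vsval v`_i.
  by rewrite /= nth_cat sz1 ltn_ord (nth_map 0) ?size_tuple.
have br (i : 'I_n) : b`_(rshift n i) = s * vsval v`_i.
  by rewrite /= nth_cat sz1 ltnNge leq_addr /= addKn (nth_map 0) ?size_tuple.
have expand (y : subvs_of F) : vsval y = \sum_i coord v i y *: vsval v`_i.
  by rewrite {1}(coord_basis vB (memvf y)) linear_sum /=; apply: eq_bigr.
have bB : basis_of {:L} b.
  have le_n : (n + n <= \dim F * 2)%N by rewrite dimF muln2 addnn.
  rewrite basisEdim size_tuple dL le_n andbT.
  apply/subvP => y _; have [p [_ [pF /mulvP[a aF ->] ->]]] :=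
    quadratic_decomposition y dL sF.
  rewrite -[p]/(vsval (Subvs pF)) -[a]/(vsval (Subvs aF)) !expand mulr_sumr.
  apply: rpredD; apply: rpred_sum => i _.
    by rewrite -bl; apply/rpredZ/memv_span/mem_nth; rewrite size_tuple.
  by rewrite -scalerAr -br; apply/rpredZ/memv_span/mem_nth; rewrite size_tuple.
have sl (i : 'I_n) : split (lshift n i) = inl i := unsplitK (inl i).
have sr (i : 'I_n) : split (rshift n i) = inr i := unsplitK (inr i).
have coordE (a1 a2 : 'I_n -> rat) y k :
    y = \sum_i a1 i *: vsval v`_i + \sum_i a2 i *: (s * vsval v`_i) ->
    coord b k y = match split k with inl i => a1 i | inr i => a2 i end.
  move=> ->; pose a j := match split j with inl i => a1 i | inr i => a2 i end.
  rewrite -[RHS]/(a k) -(coord_sum_free a k (basis_free bB)).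
  congr (coord _ _ _).
  rewrite big_split_ord; congr (_ + _); apply: eq_bigr => i _.
    by rewrite bl /a sl.
  by rewrite br /a sr.
rewrite (trace_basis _ bB) (trace_basis _ vB) big_split_ord mulr2n mulrDl mul1r.
congr (_ + _); apply: eq_bigr => i _.
  rewrite bl -rmorphM /= (coordE (fun j => coord v j (x * v`_i)) (fun=> 0)).
    by rewrite sl.
  rewrite [X in _ + X]big1 ?addr0 -?expand // => j _.
  by rewrite scale0r.
rewrite br mulrCA -rmorphM /=.
rewrite (coordE (fun=> 0) (fun j => coord v j (x * v`_i))).
  by rewrite sr.
rewrite big1 ?add0r => [|j _]; last by rewrite scale0r.
have -> : vsval x * vsval v`_i = \sum_j coord v j (x * v`_i) *: vsval v`_j.
  by rewrite -expand.
by rewrite mulr_sumr; apply: eq_bigr => j _; rewrite scalerAr.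
Qed.

Section SmallOrders.
Variable L : fieldExtType rat.
Implicit Types (O : {pred L}).

(** A generator c_0 of O meet Q satisfies c_0^2 = l c_0 and 1 = k c_0 with k and
l integers; so c_0 = l with k l = 1, and multiplying the whole basis by the unit
k turns c_0 into 1. *)
Lemma zbasis_with_1 O : is_order O ->
  exists2 c : (\dim {:L}).-tuple L, is_zbasis O c & c`_0 = 1.
Proof.
move=> Oord; have [[O1 _ OM] _] := Oord.
have [c cO] := adapted_zbasis 1%VS Oord; rewrite dimv1 => c1.
have [cB cE] := cO.
have n0 : (0 < \dim {:L})%N := adim_gt0 {:L}.
have sz1 : size (take 1 c) = 1%N by rewrite size_takel // size_tuple.
have Zc x : x \in O -> x \in 1%VS -> exists k : int, x = c`_0 *~ k.
  move=> xO x1; have x1' : x \in <<take 1 c>>%VS by rewrite (span_basis c1).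
  have [a ->] := intspan_take (basis_free cB) n0 x1' (iffLR (cE x) xO).
  by exists (a ord0); rewrite big_ord1.
have c0O : c`_0 \in O := zbasis_mem (Ordinal n0) cO.
have c01 : c`_0 \in 1%VS.
  apply: (basis_mem c1).
  by rewrite -(nth_take 0 (isT : (0 < 1)%N)) mem_nth ?sz1.
have [k kE] := Zc _ O1 (mem1v _).
have [l lE] := Zc _ (OM _ _ c0O c0O) (rpredM c01 c01).
have c00 : c`_0 != 0.
  by apply: contraTneq (oner_neq0 L) => c00; rewrite kE c00 mul0rz negbK.
have c0l : c`_0 = l%:~R by apply: (mulfI c00); rewrite lE mulrzr.
have kl : k * l = 1.
  apply/eqP; rewrite -(eqr_int rat) -(inj_eq (fmorph_inj (in_alg L))).
  by rewrite !rmorph_int intrM -c0l mulrC mulrzr -kE.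
have ku : k%:M \in @unitmx int (\dim {:L}).
  rewrite unitmxE det_scalar unitrX //; apply/unitrP; exists l.
  by rewrite mulrC kl.
exists (unimodular_tuple c k%:M); first exact: zbasis_unimodular.
rewrite -[0%N]/(nat_of_ord (Ordinal n0)) unimodular_tupleE.
rewrite (bigD1 (Ordinal n0)) //= mxE eqxx mulr1n -kE.
by rewrite big1 ?addr0 // => i /negPf i0; rewrite mxE eq_sym i0.
Qed.
End SmallOrders.

Lemma intspan_eq_seq (V : zmodType) m n (b : m.-tuple V) (c : n.-tuple V) x :
  tval b = tval c -> inIntSpan b x -> inIntSpan c x.
Proof.
move=> bc; have mn : m = n by rewrite -(size_tuple b) bc size_tuple.
by case: _ / mn in c bc *; rewrite (val_inj bc).
Qed.

Lemma det_mx22 (R : comPzRingType) (M : 'M[R]_2) :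
  \det M = M 0 0 * M 1 1 - M 0 1 * M 1 0.
Proof.
rewrite (expand_det_row _ 0) !big_ord_recl big_ord0 addr0 /cofactor !det_mx11.
rewrite !mxE /= expr0 expr1 mul1r mulN1r mulrN.
by congr (_ * M _ _ - M _ _ * M _ _); apply: val_inj.
Qed.

(** With O = Z + Z w and w^2 = a0 + a1 w, the square root is delta = 2 w - a1.
If the discriminant were nonnegative, an embedding would be real at delta, hence
at w and everywhere. *)
Lemma quadratic_order_sqrt_disc (L : fieldExtType rat) (O : {pred L}) :
  imaginary_quadratic L -> is_order O ->
  order_disc O < 0 /\
  exists2 delta, delta \in O & delta ^+ 2 = (order_disc O)%:A.
Proof.
move=> [dL Lim] Oord; have [[O1 OB OM] _] := Oord.
have [c cO c0] := zbasis_with_1 Oord; have [cB cE] := cO.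
set w := c`_1; pose e := [tuple 1; w].
have ec : tval e = tval c.
  apply: (@eq_from_nth _ 0) => [|i]; rewrite ?size_tuple ?dL //.
  by case: i => [|[|i]].
have eB : basis_of {:L} e by rewrite /= -[[:: 1; w]]/(tval e) ec.
have wO : w \in O.
  have n1 : (1 < \dim {:L})%N by rewrite dL.
  exact: (zbasis_mem (Ordinal n1) cO).
have [a w2] : inIntSpan e (w * w).
  by apply: intspan_eq_seq (esym ec) _; apply/cE/OM.
rewrite !big_ord_recl big_ord0 addr0 /= in w2.
set a0 := a _ in w2; set a1 := a _ in w2.
have {}w2 : w * w = a0%:~R *: 1 + a1%:~R *: w by rewrite w2 !scaler_int.
have eF := basis_free eB.
have co k (i : 'I_2) : coord e k e`_i = (i == k)%:R by exact: coord_free.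
have coordw2 : coord e 1 (w * w) = a1%:~R.
  rewrite w2 linearD !linearZ /=.
  by rewrite (co 1 0) (co 1 1) /= mulr0 add0r mulr1.
have tr1 : field_trace (1 : L) = 2 by rewrite trace1 dL.
have trw : field_trace w = a1%:~R.
  rewrite (trace_basis _ eB) !big_ord_recl big_ord0 addr0 /= mulr1.
  by rewrite (co ord0 1) /= add0r -coordw2; congr (coord e _ _); apply: val_inj.
have trw2 : field_trace (w * w) = 2 * a0%:~R + a1%:~R ^+ 2.
  rewrite w2 traceD !traceZ tr1 trw.
  by rewrite mulrC expr2.
have discE : order_disc O = 4 * a0%:~R + a1%:~R ^+ 2.
  rewrite (order_discE cO) (zdisc_gram c dL) det_mx22 !mxE /= c0 -/w.
  by rewrite !mul1r !mulr1 tr1 trw trw2; ring.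
pose delta := w *+ 2 - a1%:~R.
have d2 : delta ^+ 2 = (order_disc O)%:A.
  have w2L : w ^+ 2 = a0%:~R + a1%:~R * w.
    by rewrite expr2 w2 !scaler_int mulrzl.
  have discL : (order_disc O)%:A = 4 * a0%:~R + a1%:~R ^+ 2 :> L.
    rewrite -[LHS]/(in_alg L (order_disc O)) discE.
    by rewrite rmorphD rmorphM rmorphXn !rmorph_int rmorph_nat.
  rewrite discL; transitivity (4 * w ^+ 2 - 4 * w * a1%:~R + a1%:~R ^+ 2).
    by rewrite /delta; ring.
  by rewrite w2L; ring.
have wint (k : int) : k%:~R \in O.
  have -> : k%:~R = \sum_(i < 1) (1 : L) *~ k by rewrite big_ord1.
  exact: (order_sum (fun=> k) Oord).
have deltaO : delta \in O.
  by apply: OB; rewrite ?wint // -mulr_natr OM // -[2%:R]/(2%:Z%:~R) wint.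
split; last by exists delta.
have [f] := embedding_exists L; have [x /negP xr] := Lim f.
rewrite ltNge; apply/negP => d0; case: xr.
have fdr : f delta \is Num.real.
  apply: sqr_ge0_real.
  by rewrite -rmorphXn d2 embedding_alg rmorph1 mulr1 ler0q.
have fwr : f w \is Num.real.
  have -> : f w = (f delta + a1%:~R) / 2.
    rewrite /delta rmorphB rmorphMn rmorph_int subrK -mulr_natr.
    by rewrite mulfK ?pnatr_eq0.
  by rewrite realM ?realV ?realD ?realz ?realn.
rewrite (coord_basis eB (memvf x)) rmorph_sum; apply: rpred_sum => i _.
rewrite embedding_alg; apply: rpredM; first exact: (Creal_Crat (Crat_rat _)).
by case: i => [[|[|i]] lt_i] //=; rewrite rmorph1 real1.
Qed.

(** In a Z-basis starting with 1 the Gram matrix has first entry Tr(1) = 3, and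
its Schur complement is the Gram matrix of the projection orthogonal to 1.  A
nonzero vector there lifts to an element outside Q. *)
Lemma cubic_order_short (L : fieldExtType rat) (O : {pred L}) :
  \dim {:L} = 3%N -> totally_real L -> is_order O ->
  exists alpha, [/\ alpha \in O, alpha \notin 1%VS, 0 <= order_disc O &
    exists2 t : rat, 0 <= t /\ t ^+ 2 <= 4 / 9 * order_disc O &
      field_trace (alpha ^+ 2) <= 3 / 4 + t].
Proof.
move=> dL Lr Oord; have [[O1 OB OM] _] := Oord.
have [c cO c0] := zbasis_with_1 Oord; have [cB cE] := cO.
pose G : 'M_(1 + 2) := gram 3 c.
have szk : size (take 3 c) = 3%N by rewrite size_takel // size_tuple dL.
have take3 : take 3 c = c by rewrite take_oversize // size_tuple dL.
have c3B : basis_of {:L} (take 3 c) by rewrite take3.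
have Gpos : posdef G.
  split=> [|u u0]; first exact: gram_tr.
  have [_ x0] := basis_comb (fun i => u 0 i) c3B szk.
  rewrite qform_gram; apply: totally_real_trace_gt0 => //.
  apply: contraNneq u0 => /x0 u0.
  by apply/eqP/rowP => i; rewrite u0 mxE.
have GE : G = block_mx 3%:M (ursubmx G) (ursubmx G)^T (drsubmx G).
  rewrite -[LHS]submxK; congr block_mx; last by rewrite trmx_ursub Gpos.1.
  rewrite [LHS]mx11_scalar; congr _%:M.
  by rewrite !mxE /= c0 mulr1 trace1 dL.
have discE : order_disc O = 3 * \det (schur 3 (ursubmx G) (drsubmx G)).
  by rewrite (order_discE cO) (zdisc_gram c dL) -/G [in LHS]GE det_schur.
rewrite GE in Gpos; have Spos := schur_posdef (isT : 0 < 3 :> rat) Gpos.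
have [u u0 uS] := hermite Spos.
have [k kS] := schur_lift (ursubmx G) (drsubmx G) u (isT : 0 < 3 :> rat).
rewrite -GE in kS; set v : 'rV[int]_(1 + 2) := row_mx k%:M u in kS.
pose alpha := \sum_(i < 3) c`_i *~ v 0 i.
have aE : alpha = \sum_(i < 3) (map_mx intr v : 'rV[rat]_3) 0 i *: c`_i.
  by apply: eq_bigr => i _; rewrite [in RHS]mxE scaler_int.
exists alpha; split.
- apply: (order_sum _ Oord) => i.
  have lt_i : (i < \dim {:L})%N by rewrite dL.
  exact: (zbasis_mem (Ordinal lt_i) cO).
- apply: contra u0 => /vlineP[r rE].
  pose y (i : 'I_3) := (map_mx intr v : 'rV[rat]_3) 0 i - r * (i == 0)%:R.
  have [_ y0] := basis_comb y c3B szk; apply/eqP/rowP => j.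
  have /y0/(_ (rshift 1 j)) : \sum_(i < 3) y i *: c`_i = 0.
    under eq_bigr do rewrite scalerBl.
    rewrite sumrB -aE (bigD1 ord0) //= mulr1 c0 rE.
    rewrite big1 ?addr0 ?subrr // => i /negPf i0.
    by rewrite i0 mulr0 scale0r.
  rewrite /y mulr0 subr0 mxE row_mxEr => /eqP; rewrite intr_eq0 => /eqP ->.
  by rewrite mxE.
- by rewrite discE mulr_ge0 // ltW // posdef_det.
exists (qform (schur 3 (ursubmx G) (drsubmx G)) (map_mx intr u)).
  split; first by rewrite ltW // Spos.2 // map_intr_eq0.
  apply: le_trans uS _; rewrite discE expr1; lra.
by rewrite aE -qform_gram.
Qed.

Lemma CM_with_imaginary_quadratic (R : realType) (K : fieldExtType rat)
    (O : {pred K}) (K1 Kp : {subfield K}) :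
  \dim {:K} = 6%N -> is_order O ->
  imaginary_quadratic (subvs_of K1) ->
     totally_real (subvs_of Kp) -> \dim Kp = 3%N ->
     exists mu : K,
       [/\ mu \in O,
           totally_real_elt (mu ^+ 2),
           <<1; mu>>%VS = {:K}%VS
         & 0 < - (1 / 2) * (ratr (field_trace (mu ^+ 2)) : R)
             <= `|ratr (order_disc (subfield_order K1 O))|
                   * (1 + 2 * Num.sqrt
                        `|ratr (order_disc (subfield_order Kp O))|)].
Proof.
move=> dK Oord K1im Kpr dKp; have [[_ _ OM] _] := Oord.
have O1ord := subfield_is_order K1 Oord.
have Opord := subfield_is_order Kp Oord.
have [] := quadratic_order_sqrt_disc K1im O1ord.
set d := order_disc _ => d0 [delta deltaO d2].
have dM : \dim {:subvs_of Kp} = 3%N by rewrite dimvf.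
have [alpha [alphaO alpha1]] := cubic_order_short dM Kpr Opord.
set D := order_disc _ => D0 [t [t0 tD] trt].
pose mu := vsval delta * vsval alpha.
have mu2E : mu ^+ 2 = d *: vsval (alpha ^+ 2).
  have -> : vsval (alpha ^+ 2) = vsval alpha ^+ 2 by rewrite rmorphXn.
  have dE : vsval delta ^+ 2 = d%:A by rewrite -rmorphXn d2 /= algid1.
  by rewrite /mu exprMn dE mulr_algl.
have alpha0 : alpha != 0 by apply: contraNneq alpha1 => ->; apply: mem0v.
have mu2Kp : mu ^+ 2 \in Kp by rewrite mu2E rpredZ // subvsP.
have fmu (f : {rmorphism K -> algC}) : f mu ^+ 2 < 0.
  rewrite -rmorphXn mu2E embedding_alg nmulr_rlt0 ?ltrq0 // rmorphXn.
  rewrite rmorphXn real_exprn_even_gt0 ?fmorph_eq0 //.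
  by rewrite (totally_real_sub f Kpr) ?subvsP.
have [f0] := embedding_exists K.
have muKp : mu \notin Kp.
  apply/negP => /(totally_real_sub f0 Kpr) fr.
  by have := real_exprn_even_ge0 fr (isT : ~~ odd 2); rewrite (lt_geF (fmu f0)).
have mu2Q : mu ^+ 2 \notin 1%VS.
  apply: contra alpha1 => /vlineP[r rE]; apply: cubic_sqr_rational => //.
  apply/vlineP; exists (d^-1 * r); apply: val_inj.
  rewrite -scalerA linearZ /= algid1 -[_%:A in RHS]rE mu2E scalerA.
  by rewrite mulVf ?scale1r // lt_eqF.
exists mu; split.
- exact: OM.
- by move=> f; apply: totally_real_sub Kpr _.
- exact: adjoin_root_full dKp dK mu2Kp muKp mu2Q.
have trE : field_trace (mu ^+ 2) = 2 * d * field_trace (alpha ^+ 2).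
  by rewrite mu2E traceZ trace_quadratic ?dK ?dKp // mulrCA mulrA.
have tr0 : 0 < field_trace (alpha ^+ 2) by apply: totally_real_trace_gt0.
have -> : - (1 / 2) * (ratr (field_trace (mu ^+ 2)) : R) =
    ratr (- d) * ratr (field_trace (alpha ^+ 2)).
  by rewrite trE !rmorphM rmorphN /= ratr_nat; field.
have d0' : 0 < ratr (- d) :> R by rewrite ltr0q oppr_gt0.
rewrite (mulr_gt0 d0') ?ltr0q //=.
rewrite -normrN -rmorphN (gtr0_norm d0') ler_pM2l //.
have rt0 : 0 <= ratr t :> R by rewrite ler0q.
have rD0 : 0 <= ratr D :> R by rewrite ler0q.
have sD0 : 0 <= 2 * Num.sqrt `|ratr D| :> R by rewrite mulr_ge0 ?sqrtr_ge0.
have t2 : ratr t <= 2 * Num.sqrt `|ratr D| :> R.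
  rewrite -(@ler_pXn2r _ 2) ?nnegrE // [leRHS]exprMn sqr_sqrtr // ger0_norm //.
  move: tD; rewrite -(ler_rat R) rmorphXn /= rmorphM /= fmorph_div /= !ratr_nat.
  lra.
move: trt; rewrite -(ler_rat R) rmorphD /= fmorph_div /= !ratr_nat.
lra.
Qed.

Theorem proposition1p4 (R : realType) (K : fieldExtType rat) (O : {pred K}) :
  CM_field K -> \dim {:K} = 6%N -> is_order O ->
  (~ (exists K1 : {subfield K}, imaginary_quadratic (subvs_of K1)) ->
     exists mu : K,
       [/\ mu \in O,
           totally_real_elt (mu ^+ 2),
           <<1; mu>>%VS = {:K}%VS
         & 0 < - (1 / 2) * (ratr (field_trace (mu ^+ 2)) : R)
             <= (6 / pi) `^ (2 / 3) * `|ratr (order_disc O)| `^ (1 / 3)])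
  /\
  (forall K1 Kp : {subfield K},
     imaginary_quadratic (subvs_of K1) ->
     totally_real (subvs_of Kp) -> \dim Kp = 3%N ->
     exists mu : K,
       [/\ mu \in O,
           totally_real_elt (mu ^+ 2),
           <<1; mu>>%VS = {:K}%VS
         & 0 < - (1 / 2) * (ratr (field_trace (mu ^+ 2)) : R)
             <= `|ratr (order_disc (subfield_order K1 O))|
                   * (1 + 2 * Num.sqrt
                        `|ratr (order_disc (subfield_order Kp O))|)]).
Proof.
move=> KCM dK Oord; split; first exact: CM_without_imaginary_quadratic.
by move=> K1 Kp; apply: CM_with_imaginary_quadratic.
Qed.
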